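(* Over $\mathsf{RCA}_0$, $\mathsf{EM}$ implies $\mathsf{RT}^2_2$ if and only if $\mathsf{EM}$ implies $\mathsf{ADS}$. That is, $\mathsf{RCA}_0+\mathsf{EM}\vdash\mathsf{RT}^2_2$ if and only if $\mathsf{RCA}_0+\mathsf{EM}\vdash\mathsf{ADS}$.
   Context: All principles are statements of second order arithmetic; infinite structures have domain $\mathbb{N}$. $\mathsf{RT}^2_2$: every $c:[\mathbb{N}]^2\to\{0,1\}$ has an infinite homogeneous set, i.e. an infinite $H$ with $c$ constant on $[H]^2$. $\mathsf{ADS}$: for every infinite linear order $L=(\mathbb{N},<_L)$ there is an $f:\mathbb{N}\to\mathbb{N}$ with either $f(n)<_L f(m)$ for all $n<m$, or $f(n)>_L f(m)$ for all $n<m$. An infinite tournament is an irreflexive binary relation $T$ on $\mathbb{N}$ such that for all $x\neq y$ exactly one of $T(x,y)$, $T(y,x)$ holds. $\mathsf{EM}$: every infinite tournament $T$ contains an infinite transitive subtournament, i.e. an infinite set $S$ on which the relation $T$ is transitive. *)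

(* Defs.v *)
From Stdlib Require Import List.

(** * The language of second order arithmetic

    Number variables and set variables are de Bruijn indices in two separate
    name spaces: [alln] binds number index 0, [alls] binds set index 0, and
    neither affects the indices of the other sort. *)

Inductive term : Type :=
| tvar : nat -> term
| tzero : term
| tone : term
| tadd : term -> term -> term
| tmul : term -> term -> term.

Inductive form : Type :=
| bot : form
| eqn : term -> term -> form
| ltn : term -> term -> form
| mem : term -> nat -> form
| imp : form -> form -> form
| alln : form -> form
| alls : form -> form.

(** The logic is classical, so the other connectives are abbreviations. *)
Definition neg (A : form) : form := imp A bot.
Definition conj (A B : form) : form := neg (imp A (neg B)).
Definition disj (A B : form) : form := imp (neg A) B.
Definition equi (A B : form) : form := conj (imp A B) (imp B A).
Definition exn (A : form) : form := neg (alln (neg A)).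
Definition exs (A : form) : form := neg (alls (neg A)).

Declare Scope soa_scope.
Delimit Scope soa_scope with soa.
Bind Scope soa_scope with term.
Bind Scope soa_scope with form.

Notation "# n" := (tvar n) (at level 1, format "# n") : soa_scope.
Notation "s ⊕ t" := (tadd s t) (at level 50, left associativity) : soa_scope.
Notation "s ⊗ t" := (tmul s t) (at level 40, left associativity) : soa_scope.
Notation "s ≐ t" := (eqn s t) (at level 70) : soa_scope.
Notation "s ≺ t" := (ltn s t) (at level 70) : soa_scope.
Notation "t ∈ X" := (mem t X) (at level 70) : soa_scope.
Notation "¬ A" := (neg A) (at level 75, right associativity) : soa_scope.
Notation "A ∧ B" := (conj A B) (at level 80, right associativity) : soa_scope.
Notation "A ∨ B" := (disj A B) (at level 85, right associativity) : soa_scope.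
Notation "A ⟶ B" := (imp A B) (at level 90, right associativity) : soa_scope.
Notation "A ⟷ B" := (equi A B) (at level 95, no associativity) : soa_scope.

Local Open Scope soa_scope.

(** * Substitution

    The only set terms are set variables, so a substitution consists of a map
    from number variables to terms and a renaming of the set variables. *)

Fixpoint subst_term (sg : nat -> term) (t : term) : term :=
  match t with
  | tvar n => sg n
  | tzero => tzero
  | tone => tone
  | tadd s u => tadd (subst_term sg s) (subst_term sg u)
  | tmul s u => tmul (subst_term sg s) (subst_term sg u)
  end.

Definition scons {X : Type} (x : X) (f : nat -> X) (n : nat) : X :=
  match n with 0 => x | S m => f m end.

Definition shift_term (t : term) : term := subst_term (fun n => #(S n)) t.

Definition up_n (sg : nat -> term) : nat -> term :=
  scons #0 (fun n => shift_term (sg n)).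

Definition up_s (rho : nat -> nat) : nat -> nat :=
  scons 0 (fun n => S (rho n)).

Fixpoint subst (sg : nat -> term) (rho : nat -> nat) (A : form) : form :=
  match A with
  | bot => bot
  | eqn s t => eqn (subst_term sg s) (subst_term sg t)
  | ltn s t => ltn (subst_term sg s) (subst_term sg t)
  | mem t X => mem (subst_term sg t) (rho X)
  | imp B C => imp (subst sg rho B) (subst sg rho C)
  | alln B => alln (subst (up_n sg) rho B)
  | alls B => alls (subst sg (up_s rho) B)
  end.

Definition shift_n (A : form) : form :=
  subst (fun n => #(S n)) (fun X => X) A.
Definition shift_s (A : form) : form := subst tvar S A.

Definition inst_n (A : form) (t : term) : form :=
  subst (scons t tvar) (fun X => X) A.
Definition inst_s (A : form) (X : nat) : form :=
  subst tvar (scons X (fun Y => Y)) A.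

(** * Classical two-sorted natural deduction

    [T] is the set of nonlogical axioms. Since [T] is not shifted in the rules
    for introducing quantifiers, a variable occurring free in an axiom may
    be generalized: an axiom stands for its universal closure. *)

Inductive prv (T : form -> Prop) : list form -> form -> Prop :=
| prv_ax G A : T A -> prv T G A
| prv_hyp G A : In A G -> prv T G A
| prv_impI G A B : prv T (A :: G) B -> prv T G (A ⟶ B)
| prv_impE G A B : prv T G (A ⟶ B) -> prv T G A -> prv T G B
| prv_raa G A : prv T ((¬ A) :: G) bot -> prv T G A
| prv_allnI G A : prv T (map shift_n G) A -> prv T G (alln A)
| prv_allnE G A t : prv T G (alln A) -> prv T G (inst_n A t)
| prv_allsI G A : prv T (map shift_s G) A -> prv T G (alls A)
| prv_allsE G A X : prv T G (alls A) -> prv T G (inst_s A X)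
| prv_refl G t : prv T G (t ≐ t)
| prv_leibniz G A s t :
    prv T G (s ≐ t) -> prv T G (inst_n A s) -> prv T G (inst_n A t).

Definition provable (T : form -> Prop) (A : form) : Prop := prv T nil A.

Definition add_axiom (T : form -> Prop) (A : form) : form -> Prop :=
  fun B => T B \/ B = A.

(** * The theory RCA0 *)

(** In the two bounded quantifiers, the bound [t] lives outside the binder,
    hence cannot mention the quantified variable. *)
Inductive Delta00 : form -> Prop :=
| Delta00_bot : Delta00 bot
| Delta00_eqn s t : Delta00 (s ≐ t)
| Delta00_ltn s t : Delta00 (s ≺ t)
| Delta00_mem t X : Delta00 (t ∈ X)
| Delta00_imp A B : Delta00 A -> Delta00 B -> Delta00 (A ⟶ B)
| Delta00_all t A : Delta00 A -> Delta00 (alln (#0 ≺ shift_term t ⟶ A))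
| Delta00_ex t A : Delta00 A -> Delta00 (exn (#0 ≺ shift_term t ∧ A)).

Inductive Sigma01 : form -> Prop :=
| Sigma01_intro A : Delta00 A -> Sigma01 (exn A).

Inductive Pi01 : form -> Prop :=
| Pi01_intro A : Delta00 A -> Pi01 (alln A).

(** [A(n + 1)], where [n] is number index 0 on both sides. *)
Definition at_succ (A : form) : form :=
  subst (scons (#0 ⊕ tone) (fun n => #(S n))) (fun X => X) A.

(** The formulas in the two schemes may have free number and set variables
    as parameters; the use of [shift_s] in comprehension expresses that the
    set being defined does not occur in [A]. *)
Inductive RCA0 : form -> Prop :=
| RCA0_succ_neq0 : RCA0 (alln (¬ #0 ⊕ tone ≐ tzero))
| RCA0_succ_inj : RCA0 (alln (alln (#1 ⊕ tone ≐ #0 ⊕ tone ⟶ #1 ≐ #0)))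
| RCA0_add0 : RCA0 (alln (#0 ⊕ tzero ≐ #0))
| RCA0_addS : RCA0 (alln (alln (#1 ⊕ (#0 ⊕ tone) ≐ (#1 ⊕ #0) ⊕ tone)))
| RCA0_mul0 : RCA0 (alln (#0 ⊗ tzero ≐ tzero))
| RCA0_mulS : RCA0 (alln (alln (#1 ⊗ (#0 ⊕ tone) ≐ (#1 ⊗ #0) ⊕ #1)))
| RCA0_lt0 : RCA0 (alln (¬ #0 ≺ tzero))
| RCA0_ltS : RCA0 (alln (alln (#1 ≺ #0 ⊕ tone ⟷ (#1 ≺ #0 ∨ #1 ≐ #0))))
| RCA0_induction A : Sigma01 A ->
    RCA0 (inst_n A tzero ∧ alln (A ⟶ at_succ A) ⟶ alln A)
| RCA0_comprehension A B : Sigma01 A -> Pi01 B ->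
    RCA0 (alln (A ⟷ B) ⟶ exs (alln (#0 ∈ 0 ⟷ shift_s A))).

(** * Combinatorial principles

    In the following definitions the set arguments [L], [F], [C], ... are set
    indices, and the formulas bind no set variable unless [alls] or [exs]
    is displayed. *)

(** The usual pairing term [(s + t)^2 + s] of reverse mathematics; it is
    injective on pairs, but not every number is a pair. *)
Definition pair (s t : term) : term := (s ⊕ t) ⊗ (s ⊕ t) ⊕ s.

Definition infinite (X : nat) : form := alln (exn (#1 ≺ #0 ∧ #0 ∈ X)).

Definition relation (R : nat) : form :=
  alln (#0 ∈ R ⟶ exn (exn (#2 ≐ pair #1 #0))).

Definition related (R : nat) (s t : term) : form := pair s t ∈ R.

(** Functions from N to N are identified with their graphs. *)
Definition function (F : nat) : form :=
  relation F
  ∧ alln (exn (pair #1 #0 ∈ F ∧ alln (pair #2 #0 ∈ F ⟶ #0 ≐ #1))).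

(** Graphs of functions from [N]^2 to {0,1}, where the two-element set
    {x < y} is represented by the pair (x, y). *)
Definition coloring (C : nat) : form :=
  alln (#0 ∈ C ⟶
    exn (exn (exn (#2 ≺ #1 ∧ (#0 ≐ tzero ∨ #0 ≐ tone)
                   ∧ #3 ≐ pair (pair #2 #1) #0))))
  ∧ alln (alln (#1 ≺ #0 ⟶
      exn ((#0 ≐ tzero ∨ #0 ≐ tone) ∧ pair (pair #2 #1) #0 ∈ C
           ∧ alln (pair (pair #3 #2) #0 ∈ C ⟶ #0 ≐ #1)))).

Definition homogeneous (C H : nat) : form :=
  exn (alln (alln (#1 ∈ H ∧ #0 ∈ H ∧ #1 ≺ #0 ⟶
                   pair (pair #1 #0) #2 ∈ C))).

Definition RT22 : form :=
  alls (coloring 0 ⟶ exs (infinite 0 ∧ homogeneous 1 0)).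

(** Strict linear orders with domain N. *)
Definition linear_order (L : nat) : form :=
  relation L
  ∧ alln (¬ related L #0 #0)
  ∧ alln (alln (alln (related L #2 #1 ∧ related L #1 #0 ⟶ related L #2 #0)))
  ∧ alln (alln (¬ #1 ≐ #0 ⟶ related L #1 #0 ∨ related L #0 #1)).

Definition ascending (L F : nat) : form :=
  alln (alln (#1 ≺ #0 ⟶
    alln (alln (pair #3 #1 ∈ F ∧ pair #2 #0 ∈ F ⟶ related L #1 #0)))).

Definition descending (L F : nat) : form :=
  alln (alln (#1 ≺ #0 ⟶
    alln (alln (pair #3 #1 ∈ F ∧ pair #2 #0 ∈ F ⟶ related L #0 #1)))).

Definition ADS : form :=
  alls (linear_order 0 ⟶
    exs (function 0 ∧ (ascending 1 0 ∨ descending 1 0))).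

Definition tournament (T : nat) : form :=
  relation T
  ∧ alln (¬ related T #0 #0)
  ∧ alln (alln (¬ #1 ≐ #0 ⟶
      (related T #1 #0 ∧ ¬ related T #0 #1)
      ∨ (related T #0 #1 ∧ ¬ related T #1 #0))).

Definition transitive_on (T S : nat) : form :=
  alln (alln (alln (#2 ∈ S ∧ #1 ∈ S ∧ #0 ∈ S ⟶
    related T #2 #1 ∧ related T #1 #0 ⟶ related T #2 #0))).

Definition EM : form :=
  alls (tournament 0 ⟶ exs (infinite 0 ∧ transitive_on 1 0)).

(* Main.v *)
(** Every unprovable sentence fails in a term model, so it suffices to argue
    inside such models. There every number and every set is named, hence may be
    used as a parameter in comprehension and induction.

    RT22 implies ADS: colour [x < y] by whether the linear order agrees with the
    usual order on [x] and [y], and enumerate a homogeneous set increasingly.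

    EM and ADS imply RT22: a colouring [c] gives the tournament with an arrow from
    [x] to [y], for [x < y], iff [c x y = 1]. A tournament is a linear order on
    any transitive infinite set, which is transferred to N by enumerating the set;
    on the values of a monotone sequence that appear in increasing order, [c] is
    constant.

    The enumeration needs primitive recursion, hence a coding of finite sets: the
    pair (a, b) codes the set of those [x] for which [(x + 1) b + 1] divides [a]. *)

From Stdlib Require Import List Arith Lia Cantor Ring.
From Stdlib Require Import Classical ClassicalEpsilon FunctionalExtensionality PropExtensionality.
Require Import Defs.

(** The splitting of RT22 into EM and ADS goes back to Bovykin and Weiermann. What shapes the formal
    proof is the weakness of the axioms: only Σ01 induction and Δ01 comprehension are at hand.
    Induction statements are therefore phrased existentially, and each set that is not given by a
    bounded formula needs a Σ01 description of its complement, often won from totality: a pair is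
    outside a graph when the function takes another value. The sequence given by ADS may jump up and
    down in the usual order and its range need not be a set, so it is thinned out to an increasing
    part. That this part is infinite rests on a pigeonhole principle, proved through divisibility
    because finite cardinalities are not developed. Equality in the term model is made into Rocq's
    own equality, so that rewriting and [ring] apply. *)

(** * Substitution calculus *)

Lemma subst_term_comp sg sg' t :
  subst_term sg' (subst_term sg t) = subst_term (fun n => subst_term sg' (sg n)) t.
Proof. induction t; cbn; congruence. Qed.

Lemma subst_term_id t : subst_term tvar t = t.
Proof. induction t; cbn; congruence. Qed.

Lemma up_n_comp sg sg' :
  (fun n => subst_term (up_n sg') (up_n sg n)) = up_n (fun n => subst_term sg' (sg n)).
Proof.
  extensionality n; destruct n; [reflexivity|].
  cbn; unfold shift_term; now rewrite !subst_term_comp.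
Qed.

Lemma up_s_comp rho rho' :
  (fun X => up_s rho' (up_s rho X)) = up_s (fun X => rho' (rho X)).
Proof. extensionality X; now destruct X. Qed.

Lemma subst_comp A : forall sg rho sg' rho',
  subst sg' rho' (subst sg rho A)
  = subst (fun n => subst_term sg' (sg n)) (fun X => rho' (rho X)) A.
Proof.
  induction A; intros; cbn; rewrite ?subst_term_comp; try congruence.
  - now rewrite IHA1, IHA2.
  - now rewrite IHA, up_n_comp.
  - now rewrite IHA, up_s_comp.
Qed.

Lemma subst_id A : subst tvar (fun X => X) A = A.
Proof.
  assert (Hn : up_n tvar = tvar) by (extensionality n; now destruct n).
  assert (Hs : up_s (fun X => X) = fun X => X) by (extensionality X; now destruct X).
  induction A; cbn; rewrite ?subst_term_id, ?Hn, ?Hs; congruence.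
Qed.

Ltac subst_eq :=
  unfold inst_n, inst_s, shift_n, shift_s, shift_term, at_succ;
  rewrite ?subst_comp, ?subst_term_comp; f_equal;
  let n := fresh in extensionality n; try destruct n; cbn;
  unfold shift_term; rewrite ?subst_term_comp, ?subst_term_id; try reflexivity;
  cbn; rewrite ?subst_term_id; try reflexivity.

Lemma inst_n_subst sg rho A t :
  subst sg rho (inst_n A t) = inst_n (subst (up_n sg) rho A) (subst_term sg t).
Proof. subst_eq. Qed.

Lemma inst_s_subst sg rho A X :
  subst sg rho (inst_s A X) = inst_s (subst sg (up_s rho) A) (rho X).
Proof. subst_eq. Qed.

Lemma shift_n_subst sg rho A :
  subst (up_n sg) rho (shift_n A) = shift_n (subst sg rho A).
Proof. subst_eq. Qed.

Lemma shift_s_subst sg rho A :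
  subst sg (up_s rho) (shift_s A) = shift_s (subst sg rho A).
Proof. subst_eq. Qed.

Lemma at_succ_subst sg rho A :
  subst (up_n sg) rho (at_succ A) = at_succ (subst (up_n sg) rho A).
Proof. subst_eq. Qed.

Lemma shift_term_subst sg t :
  subst_term (up_n sg) (shift_term t) = shift_term (subst_term sg t).
Proof. subst_eq. Qed.

Lemma inst_shift_term s t : subst_term (scons t tvar) (shift_term s) = s.
Proof. unfold shift_term; rewrite subst_term_comp; apply subst_term_id. Qed.

Lemma inst_n_up A t sg rho :
  inst_n (subst (up_n sg) rho A) t = subst (scons t sg) rho A.
Proof. subst_eq. Qed.

Lemma inst_s_up A X sg rho :
  inst_s (subst sg (up_s rho) A) X = subst sg (scons X rho) A.
Proof.
  unfold inst_s; rewrite subst_comp; f_equal.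
  - extensionality n; apply subst_term_id.
  - extensionality Y; now destruct Y.
Qed.

(** * Completeness *)

(** Free variables of axioms count as universally quantified, so derivations are stable under
    substitution only if the axioms are. *)
Definition subst_closed (T : form -> Prop) : Prop :=
  forall sg rho A, T A -> T (subst sg rho A).

Lemma Delta00_subst A : Delta00 A -> forall sg rho, Delta00 (subst sg rho A).
Proof.
  induction 1; intros; cbn; unfold exn, conj, neg in *; cbn;
    rewrite ?shift_term_subst; now constructor.
Qed.

(** The two schemes absorb substitutions into their parameters; all other axioms are sentences,
    which substitution leaves unchanged by computation. *)
Lemma RCA0_EM_subst_closed : subst_closed (add_axiom RCA0 EM).
Proof.
  intros sg rho A [H| ->]; [left|now right].
  destruct H; try (cbn; constructor).
  - destruct H as [A HA].
    change (RCA0 (imp (conj (subst sg rho (inst_n (exn A) tzero))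
      (alln (imp (subst (up_n sg) rho (exn A)) (subst (up_n sg) rho (at_succ (exn A))))))
      (alln (subst (up_n sg) rho (exn A))))).
    rewrite inst_n_subst, at_succ_subst.
    apply RCA0_induction.
    apply (Sigma01_intro (subst (up_n (up_n sg)) rho A)).
    now apply Delta00_subst.
  - change (RCA0 (imp
      (alln (equi (subst (up_n sg) rho A) (subst (up_n sg) rho B)))
      (exs (alln (equi (mem (tvar 0) 0) (subst (up_n sg) (up_s rho) (shift_s A))))))).
    rewrite shift_s_subst.
    apply RCA0_comprehension.
    + destruct H as [A HA]; apply (Sigma01_intro (subst (up_n (up_n sg)) rho A)).
      now apply Delta00_subst.
    + destruct H0 as [B HB]; apply (Pi01_intro (subst (up_n (up_n sg)) rho B)).
      now apply Delta00_subst.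
Qed.

Lemma weakening T G A : prv T G A -> forall G', incl G G' -> prv T G' A.
Proof.
  induction 1; intros G' HG.
  - now apply prv_ax.
  - apply prv_hyp; auto.
  - apply prv_impI, IHprv; intros x [->|Hx]; cbn; auto.
  - eapply prv_impE; eauto.
  - apply prv_raa, IHprv; intros x [->|Hx]; cbn; auto.
  - apply prv_allnI, IHprv, incl_map, HG.
  - apply prv_allnE; auto.
  - apply prv_allsI, IHprv, incl_map, HG.
  - apply prv_allsE; auto.
  - apply prv_refl.
  - eapply prv_leibniz; eauto.
Qed.

Lemma prv_subst T : subst_closed T -> forall G A, prv T G A ->
  forall sg rho, prv T (map (subst sg rho) G) (subst sg rho A).
Proof.
  intros HT G A H; induction H; intros sg rho.
  - now apply prv_ax, HT.
  - now apply prv_hyp, in_map.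
  - apply prv_impI, IHprv.
  - exact (prv_impE _ _ _ _ (IHprv1 sg rho) (IHprv2 sg rho)).
  - apply prv_raa, IHprv.
  - apply prv_allnI. fold subst.
    specialize (IHprv (up_n sg) rho).
    rewrite map_map in *.
    erewrite map_ext; [exact IHprv|]; intros; symmetry; apply shift_n_subst.
  - rewrite inst_n_subst; apply prv_allnE, IHprv.
  - apply prv_allsI. fold subst.
    specialize (IHprv sg (up_s rho)).
    rewrite map_map in *.
    erewrite map_ext; [exact IHprv|]; intros; symmetry; apply shift_s_subst.
  - rewrite inst_s_subst; apply prv_allsE, IHprv.
  - apply prv_refl.
  - rewrite inst_n_subst in *.
    eapply prv_leibniz; [apply IHprv1|].
    specialize (IHprv2 sg rho); now rewrite inst_n_subst in IHprv2.
Qed.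

(** The bounds need not be sharp: bound variables are counted as well. *)
Fixpoint bound_t (t : term) : nat :=
  match t with
  | tvar n => S n
  | tzero | tone => 0
  | tadd s t | tmul s t => max (bound_t s) (bound_t t)
  end.

Fixpoint bound_n (A : form) : nat :=
  match A with
  | bot => 0
  | eqn s t | ltn s t => max (bound_t s) (bound_t t)
  | mem t _ => bound_t t
  | imp A B => max (bound_n A) (bound_n B)
  | alln A | alls A => bound_n A
  end.

Fixpoint bound_s (A : form) : nat :=
  match A with
  | bot | eqn _ _ | ltn _ _ => 0
  | mem _ X => S X
  | imp A B => max (bound_s A) (bound_s B)
  | alln A | alls A => bound_s A
  end.

Lemma subst_term_bound t sg sg' :
  (forall n, n < bound_t t -> sg n = sg' n) -> subst_term sg t = subst_term sg' t.
Proof.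
  induction t; cbn; intros H; auto; rewrite IHt1, IHt2; auto; intros; apply H; lia.
Qed.

Lemma subst_bound A : forall sg sg' rho rho',
  (forall n, n < bound_n A -> sg n = sg' n) ->
  (forall X, X < bound_s A -> rho X = rho' X) ->
  subst sg rho A = subst sg' rho' A.
Proof.
  induction A; cbn; intros sg sg' rho rho' Hn Hs; f_equal;
    try reflexivity; try (apply subst_term_bound; intros; apply Hn; lia).
  - apply Hs; lia.
  - apply IHA1; intros; [apply Hn|apply Hs]; lia.
  - apply IHA2; intros; [apply Hn|apply Hs]; lia.
  - apply IHA; auto; intros [|n] H; cbn; auto; rewrite Hn; auto; lia.
  - apply IHA; auto; intros [|n] H; cbn; auto; rewrite Hs; auto; lia.
Qed.

Definition list_bound (b : form -> nat) (G : list form) : nat := list_max (map b G).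

Lemma list_bound_in b G A : In A G -> b A <= list_bound b G.
Proof.
  intros H.
  assert (HG : list_max (map b G) <= list_max (map b G)) by lia.
  apply list_max_le in HG; rewrite Forall_forall in HG; now apply HG, in_map.
Qed.

(** A fresh named variable [k] acts as eigenvariable: the substitution sending [k] to index 0 and
    raising the other indices turns [G] into its shift and the instance back into [C]. The bound on
    [C] is [S k] because [C] sits under a binder. *)
Lemma generalize_n T G C k : subst_closed T ->
  list_bound bound_n G <= k -> bound_n C <= S k ->
  prv T G (inst_n C (tvar k)) -> prv T G (alln C).
Proof.
  intros HT HG HC H.
  set (sg := fun n => if Nat.eq_dec n k then tvar 0 else tvar (S n)).
  assert (Hsg : forall n, n < k -> sg n = tvar (S n)).
  { intros n Hn; unfold sg; destruct (Nat.eq_dec n k); [lia|reflexivity]. }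
  apply prv_allnI.
  replace (map shift_n G) with (map (subst sg (fun X => X)) G).
  2:{ apply map_ext_in; intros A HA; apply list_bound_in with (b := bound_n) in HA.
      apply subst_bound; auto; intros; apply Hsg; lia. }
  replace C with (subst sg (fun X => X) (inst_n C (tvar k))); [now apply prv_subst|].
  unfold inst_n; rewrite subst_comp; rewrite <- (subst_id C) at 2.
  apply subst_bound; auto; intros [|n] Hn; cbn.
  - unfold sg; destruct (Nat.eq_dec k k); [reflexivity|lia].
  - apply Hsg; lia.
Qed.

Lemma generalize_s T G C k : subst_closed T ->
  list_bound bound_s G <= k -> bound_s C <= S k ->
  prv T G (inst_s C k) -> prv T G (alls C).
Proof.
  intros HT HG HC H.
  set (rho := fun X => if Nat.eq_dec X k then 0 else S X).
  assert (Hrho : forall X, X < k -> rho X = S X).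
  { intros X HX; unfold rho; destruct (Nat.eq_dec X k); [lia|reflexivity]. }
  apply prv_allsI.
  replace (map shift_s G) with (map (subst tvar rho) G).
  2:{ apply map_ext_in; intros A HA; apply list_bound_in with (b := bound_s) in HA.
      apply subst_bound; auto; intros; apply Hrho; lia. }
  replace C with (subst tvar rho (inst_s C k)); [now apply prv_subst|].
  unfold inst_s; rewrite subst_comp; rewrite <- (subst_id C) at 2.
  apply subst_bound; auto; intros [|X] HX; cbn.
  - unfold rho; destruct (Nat.eq_dec k k); [reflexivity|lia].
  - apply Hrho; lia.
Qed.

(** Numbering the formulas lets the Lindenbaum construction run through all of them. *)
Fixpoint code_term (t : term) : nat :=
  match t with
  | tvar n => to_nat (0, n)
  | tzero => to_nat (1, 0)
  | tone => to_nat (2, 0)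
  | tadd s t => to_nat (3, to_nat (code_term s, code_term t))
  | tmul s t => to_nat (4, to_nat (code_term s, code_term t))
  end.

Fixpoint code_form (A : form) : nat :=
  match A with
  | bot => to_nat (0, 0)
  | eqn s t => to_nat (1, to_nat (code_term s, code_term t))
  | ltn s t => to_nat (2, to_nat (code_term s, code_term t))
  | mem t X => to_nat (3, to_nat (code_term t, X))
  | imp A B => to_nat (4, to_nat (code_form A, code_form B))
  | alln A => to_nat (5, code_form A)
  | alls A => to_nat (6, code_form A)
  end.

Local Opaque to_nat.

Ltac code_inj :=
  repeat match goal with
  | H : to_nat _ = to_nat _ |- _ => 
      apply to_nat_inj in H; first [discriminate H | injection H; clear H; intros]
  end.

Lemma code_term_inj s : forall t, code_term s = code_term t -> s = t.
Proof.
  induction s; intros [] H; cbn in H; code_inj;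
    f_equal; auto.
Qed.

Lemma code_form_inj A : forall B, code_form A = code_form B -> A = B.
Proof.
  induction A; intros [] H; cbn in H; code_inj;
    f_equal; auto using code_term_inj.
Qed.

(** Set variables range over [nat] itself: in the term model every set is the
    value of a variable. *)
Record model : Type := Model {
  num :> Type;
  zero : num;
  one : num;
  add : num -> num -> num;
  mul : num -> num -> num;
  lt : num -> num -> Prop;
  el : num -> nat -> Prop;
  var : nat -> num
}.

Fixpoint eval_term (M : model) (v : nat -> M) (t : term) : M :=
  match t with
  | tvar n => v n
  | tzero => zero M
  | tone => one M
  | tadd s t => add M (eval_term M v s) (eval_term M v t)
  | tmul s t => mul M (eval_term M v s) (eval_term M v t)
  end.

Fixpoint eval (M : model) (v : nat -> M) (V : nat -> nat) (A : form) : Prop :=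
  match A with
  | bot => False
  | eqn s t => eval_term M v s = eval_term M v t
  | ltn s t => lt M (eval_term M v s) (eval_term M v t)
  | mem t X => el M (eval_term M v t) (V X)
  | imp A B => eval M v V A -> eval M v V B
  | alln A => forall x, eval M (scons x v) V A
  | alls A => forall X, eval M v (scons X V) A
  end.

Definition holds (M : model) (A : form) : Prop := eval M (var M) (fun X => X) A.

Definition named (M : model) : Prop := forall x : M, exists t, eval_term M (var M) t = x.

(** Applied to provable equality of terms, this lets [eqn] be interpreted by Rocq equality. The
    classes are predicates, compared by extensionality. *)
Lemma quotient (X : Type) (R : X -> X -> Prop) :
  (forall x, R x x) -> (forall x y, R x y -> R y x) ->
  (forall x y z, R x y -> R y z -> R x z) ->
  exists (Q : Type) (cls : X -> Q),
    (forall q, exists x, cls x = q) /\ (forall x y, cls x = cls y <-> R x y).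
Proof.
  intros Hr Hs Ht.
  exists {c : X -> Prop | exists x, c = R x}, (fun x => exist _ (R x) (ex_intro _ x eq_refl)).
  split.
  - intros [c [x Hx]]; exists x; subst c; f_equal; apply proof_irrelevance.
  - intros x y; split; intros H.
    + injection H; intros E; rewrite E; apply Hr.
    + assert (E : R x = R y)
        by (extensionality z; apply propositional_extensionality; split; eauto).
      generalize (ex_intro (fun z => R x = R z) x eq_refl) as p.
      generalize (ex_intro (fun z => R y = R z) y eq_refl) as q.
      rewrite <- E; intros p q; f_equal; apply proof_irrelevance.
Qed.

Section Henkin.

Variable T : form -> Prop.
Hypothesis HT : subst_closed T.
Variable A0 : form.
Hypothesis HA0 : ~ provable T A0.

(** Henkin witnesses are ordinary variables: every stage is a finite list, so a fresh variable
    always exists and the language need not be extended. *)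
Definition witness (G : list form) (B : form) : list form :=
  match B with
  | imp (alln C) bot => neg (inst_n C (tvar (list_bound bound_n (B :: G)))) :: nil
  | imp (alls C) bot => neg (inst_s C (list_bound bound_s (B :: G))) :: nil
  | _ => nil
  end.

Lemma witness_consistent G B :
  prv T (witness G B ++ B :: G) bot -> prv T (B :: G) bot.
Proof.
  intros H; destruct B as [| | | |B1 B2| |]; try exact H.
  destruct B1 as [| | | | |C|C]; try exact H; destruct B2; try exact H.
  - apply prv_impE with (alln C); [apply prv_hyp; now left|].
    apply prv_raa in H; eapply generalize_n in H; eauto.
    pose proof (list_bound_in bound_n (imp (alln C) bot :: G) _ (or_introl eq_refl)).
    cbn [bound_n] in H0; lia.
  - apply prv_impE with (alls C); [apply prv_hyp; now left|].
    apply prv_raa in H; eapply generalize_s in H; eauto.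
    pose proof (list_bound_in bound_s (imp (alls C) bot :: G) _ (or_introl eq_refl)).
    cbn [bound_s] in H0; lia.
Qed.

(** Numbers that code nothing yield an arbitrary formula; this is harmless, since [stage] tests
    consistency before accepting it. *)
Definition decode (n : nat) : form := epsilon (inhabits bot) (fun A => code_form A = n).

Lemma decode_code A : decode (code_form A) = A.
Proof.
  apply code_form_inj; unfold decode.
  apply (epsilon_spec (inhabits bot) (fun B => code_form B = code_form A)); now exists A.
Qed.

Fixpoint stage (n : nat) : list form :=
  match n with
  | 0 => neg A0 :: nil
  | S n =>
      if excluded_middle_informative (prv T (decode n :: stage n) bot)
      then stage n
      else witness (stage n) (decode n) ++ decode n :: stage n
  end.

Lemma stage_consistent n : ~ prv T (stage n) bot.
Proof.
  induction n as [|n IH]; cbn.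
  - intros H; now apply HA0, prv_raa.
  - destruct (excluded_middle_informative _) as [H|H]; auto.
    intros H'; now apply H, witness_consistent.
Qed.

Lemma stage_mono n m : n <= m -> incl (stage n) (stage m).
Proof.
  induction 1 as [|m _ IH]; [apply incl_refl|].
  intros A HA; apply IH in HA; cbn.
  destruct (excluded_middle_informative _); auto.
  apply in_or_app; right; now right.
Qed.

Definition thm (A : form) : Prop := exists n, prv T (stage n) A.

Lemma thm_provable A : provable T A -> thm A.
Proof. intros H; exists 0; eapply weakening; eauto; intros x []. Qed.

Lemma thm_bot : ~ thm bot.
Proof. intros [n H]; eapply stage_consistent; eauto. Qed.

Lemma thm_mp A B : thm (imp A B) -> thm A -> thm B.
Proof.
  intros [n Hn] [m Hm]; exists (max n m); eapply prv_impE.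
  - eapply weakening; [apply Hn|apply stage_mono; lia].
  - eapply weakening; [apply Hm|apply stage_mono; lia].
Qed.

Lemma stage_decides A :
  prv T (A :: stage (code_form A)) bot \/
  incl (witness (stage (code_form A)) A ++ A :: nil) (stage (S (code_form A))).
Proof.
  cbn; rewrite decode_code; destruct (excluded_middle_informative _); [now left|right].
  intros x Hx; apply in_or_app; apply in_app_or in Hx; cbn in *; tauto.
Qed.

Lemma thm_neg A : ~ thm A -> thm (neg A).
Proof.
  intros H; destruct (stage_decides A) as [H'|H'].
  - eexists; apply prv_impI, H'.
  - destruct H; eexists; apply prv_hyp, H', in_or_app; right; now left.
Qed.

(** A theorem cannot have been rejected at its own stage, so its witnesses were added along with
    it. *)
Lemma thm_neg_witness A :
  thm (neg A) -> forall B, In B (witness (stage (code_form (neg A))) (neg A)) -> thm B.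
Proof.
  intros H B HB; destruct (stage_decides (neg A)) as [H'|H'].
  - destruct thm_bot; apply thm_mp with (neg A); [|exact H]; eexists; apply prv_impI, H'.
  - eexists; apply prv_hyp, H', in_or_app; now left.
Qed.

Lemma thm_contra A : thm A -> thm (neg A) -> False.
Proof. intros H H'; apply thm_bot; eapply thm_mp; eauto. Qed.

Lemma thm_imp A B : thm (imp A B) <-> (thm A -> thm B).
Proof.
  split; [apply thm_mp|]; intros H.
  destruct (classic (thm B)) as [[n Hn]|HB].
  - exists n; apply prv_impI; eapply weakening; eauto; intros x; now right.
  - assert (HA : thm (neg A)) by (apply thm_neg; tauto).
    destruct HA as [n Hn]; exists n.
    apply prv_impI, prv_raa, prv_impE with A; [|apply prv_hyp; cbn; tauto].
    eapply weakening; eauto; intros x; cbn; tauto.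
Qed.

Lemma thm_alln A : thm (alln A) <-> forall t, thm (inst_n A t).
Proof.
  split; [intros [n Hn] t; exists n; now apply prv_allnE|]; intros H.
  apply NNPP; intros H'; apply thm_neg in H'.
  eapply thm_contra; [apply H|].
  eapply (thm_neg_witness _ H'); cbn; left; reflexivity.
Qed.

Lemma thm_alls A : thm (alls A) <-> forall X, thm (inst_s A X).
Proof.
  split; [intros [n Hn] X; exists n; now apply prv_allsE|]; intros H.
  apply NNPP; intros H'; apply thm_neg in H'.
  eapply thm_contra; [apply H|].
  eapply (thm_neg_witness _ H'); cbn; left; reflexivity.
Qed.

Lemma thm_leibniz A s t : thm (eqn s t) -> thm (inst_n A s) -> thm (inst_n A t).
Proof.
  intros [n Hn] [m Hm]; exists (max n m); eapply prv_leibniz.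
  - eapply weakening; [apply Hn|apply stage_mono; lia].
  - eapply weakening; [apply Hm|apply stage_mono; lia].
Qed.

Lemma thm_refl t : thm (eqn t t).
Proof. exists 0; apply prv_refl. Qed.

Lemma thm_sym s t : thm (eqn s t) -> thm (eqn t s).
Proof.
  intros H.
  pose proof (thm_leibniz (eqn (tvar 0) (shift_term s)) _ _ H) as H'.
  unfold inst_n in H'; cbn in H'; rewrite !inst_shift_term in H'; apply H', thm_refl.
Qed.

Lemma thm_trans s t u : thm (eqn s t) -> thm (eqn t u) -> thm (eqn s u).
Proof.
  intros H1 H2.
  pose proof (thm_leibniz (eqn (shift_term s) (tvar 0)) _ _ H2) as H'.
  unfold inst_n in H'; cbn in H'; rewrite !inst_shift_term in H'; auto.
Qed.

Lemma thm_rewrite A s t :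
  thm (eqn s t) -> (thm (inst_n A s) <-> thm (inst_n A t)).
Proof. intros H; split; apply thm_leibniz; auto using thm_sym. Qed.

Ltac thm_rewrite A H :=
  let E := fresh in
  pose proof (thm_rewrite A _ _ H) as E; unfold inst_n in E; cbn in E;
  rewrite ?inst_shift_term in E.

Lemma thm_tadd s s' t t' :
  thm (eqn s s') -> thm (eqn t t') -> thm (eqn (tadd s t) (tadd s' t')).
Proof.
  intros Hs Ht.
  thm_rewrite (eqn (shift_term (tadd s t)) (tadd (tvar 0) (shift_term t))) Hs.
  thm_rewrite (eqn (shift_term (tadd s t)) (tadd (shift_term s') (tvar 0))) Ht.
  apply H0, H, thm_refl.
Qed.

Lemma thm_tmul s s' t t' :
  thm (eqn s s') -> thm (eqn t t') -> thm (eqn (tmul s t) (tmul s' t')).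
Proof.
  intros Hs Ht.
  thm_rewrite (eqn (shift_term (tmul s t)) (tmul (tvar 0) (shift_term t))) Hs.
  thm_rewrite (eqn (shift_term (tmul s t)) (tmul (shift_term s') (tvar 0))) Ht.
  apply H0, H, thm_refl.
Qed.

Lemma thm_ltn s s' t t' :
  thm (eqn s s') -> thm (eqn t t') -> (thm (ltn s t) <-> thm (ltn s' t')).
Proof.
  intros Hs Ht.
  thm_rewrite (ltn (tvar 0) (shift_term t)) Hs.
  thm_rewrite (ltn (shift_term s') (tvar 0)) Ht.
  tauto.
Qed.

Lemma thm_mem s s' X : thm (eqn s s') -> (thm (mem s X) <-> thm (mem s' X)).
Proof. exact (thm_rewrite (mem (tvar 0) X) s s'). Qed.

Lemma term_model :
  exists M, named M /\ (forall B, provable T B -> holds M B) /\ ~ holds M A0.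
Proof.
  destruct (quotient term (fun s t => thm (eqn s t)) thm_refl thm_sym thm_trans)
    as (Q & cls & Hsurj & Hcls).
  destruct (choice (fun q t => cls t = q) Hsurj) as [rep Hrep].
  assert (Hrc : forall t, thm (eqn (rep (cls t)) t)) by (intros t; now apply Hcls).
  set (M := Model Q (cls tzero) (cls tone)
    (fun x y => cls (tadd (rep x) (rep y))) (fun x y => cls (tmul (rep x) (rep y)))
    (fun x y => thm (ltn (rep x) (rep y))) (fun x X => thm (mem (rep x) X))
    (fun n => cls (tvar n))).
  assert (Ht : forall sg t, eval_term M (fun n => cls (sg n)) t = cls (subst_term sg t)).
  { intros sg t; induction t; cbn in *; auto; rewrite IHt1, IHt2; apply Hcls;
      auto using thm_tadd, thm_tmul. }
  assert (Hsc : forall t sg,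
    (fun n => cls (scons t sg n)) = scons (cls t) (fun n => cls (sg n)))
    by (intros t sg; extensionality n; now destruct n).
  (* The truth lemma is stated for all valuations by terms, not only for the identity, so that the
     induction passes under quantifiers. *)
  assert (HA : forall A sg rho,
    eval M (fun n => cls (sg n)) rho A <-> thm (subst sg rho A)).
  { induction A; intros sg rho; cbn; rewrite ?Ht.
    - split; [tauto|apply thm_bot].
    - apply Hcls.
    - apply thm_ltn; auto.
    - apply thm_mem; auto.
    - now rewrite thm_imp, IHA1, IHA2.
    - rewrite thm_alln; split; intros H.
      + intros t; rewrite inst_n_up, <- IHA.
        rewrite Hsc; apply H.
      + intros x; destruct (Hsurj x) as [t <-].
        specialize (H t); rewrite inst_n_up, <- IHA, Hsc in H; exact H.
    - rewrite thm_alls; split; intros H X.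
      + rewrite inst_s_up, <- IHA; apply H.
      + specialize (H X); rewrite inst_s_up, <- IHA in H; apply H. }
  assert (Hh : forall A, holds M A <-> thm A).
  { intros A; unfold holds; rewrite <- (subst_id A) at 2; apply (HA A tvar (fun X => X)). }
  exists M; repeat split.
  - intros x; destruct (Hsurj x) as [t <-]; exists t.
    transitivity (cls (subst_term tvar t)); [apply (Ht tvar)|now rewrite subst_term_id].
  - intros B HB; now apply Hh, thm_provable.
  - rewrite Hh; intros H; eapply thm_contra; [exact H|].
    exists 0; apply prv_hyp; now left.
Qed.

End Henkin.

(* Semantics in a named model of RCA0 *)
Declare Scope model_scope.
Delimit Scope model_scope with model.

Section Model.

Variable M : model.
Hypothesis M_named : named M.
Hypothesis M_RCA0 : forall A, RCA0 A -> holds M A.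

Local Notation "0" := (zero M) : model_scope.
Local Notation "1" := (one M) : model_scope.
Local Notation "x + y" := (add M x y) : model_scope.
Local Notation "x * y" := (mul M x y) : model_scope.
Local Notation "x < y" := (lt M x y) : model_scope.
Local Open Scope model_scope.
Implicit Types x y z a b c d i j p q : M.

Lemma eval_term_subst v sg t :
  eval_term M v (subst_term sg t) = eval_term M (fun n => eval_term M v (sg n)) t.
Proof. induction t; cbn; congruence. Qed.

Lemma eval_term_shift v x t : eval_term M (scons x v) (shift_term t) = eval_term M v t.
Proof. apply eval_term_subst. Qed.

Lemma eval_subst A : forall v V sg rho,
  eval M v V (subst sg rho A)
  <-> eval M (fun n => eval_term M v (sg n)) (fun X => V (rho X)) A.
Proof.
  induction A; intros; cbn; rewrite ?eval_term_subst; try reflexivity.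
  - now rewrite IHA1, IHA2.
  - assert (E : forall x, (fun n => eval_term M (scons x v) (up_n sg n))
      = scons x (fun n => eval_term M v (sg n)))
      by (intros x; extensionality n; destruct n; [reflexivity|apply eval_term_shift]).
    split; intros H x; specialize (H x); rewrite IHA, E in *; exact H.
  - assert (E : forall X, (fun Y => scons X V (up_s rho Y))
      = scons X (fun Y => V (rho Y)))
      by (intros X; extensionality Y; now destruct Y).
    split; intros H X; specialize (H X); rewrite IHA, E in *; exact H.
Qed.

(** The readings [P] and [Q] are arbitrary, so that [reify] can decompose a formula and its intended
    meaning in parallel. *)
Lemma eval_conj v V A B (P Q : Prop) :
  (eval M v V A <-> P) -> (eval M v V B <-> Q) -> (eval M v V (conj A B) <-> P /\ Q).
Proof. cbn; tauto. Qed.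

Lemma eval_disj v V A B (P Q : Prop) :
  (eval M v V A <-> P) -> (eval M v V B <-> Q) -> (eval M v V (disj A B) <-> P \/ Q).
Proof. cbn; tauto. Qed.

Lemma eval_equi v V A B (P Q : Prop) :
  (eval M v V A <-> P) -> (eval M v V B <-> Q) -> (eval M v V (equi A B) <-> (P <-> Q)).
Proof. cbn; tauto. Qed.

Lemma eval_neg v V A (P : Prop) : (eval M v V A <-> P) -> (eval M v V (neg A) <-> ~ P).
Proof. cbn; tauto. Qed.

Lemma eval_imp v V A B (P Q : Prop) :
  (eval M v V A <-> P) -> (eval M v V B <-> Q) -> (eval M v V (imp A B) <-> (P -> Q)).
Proof. cbn; tauto. Qed.

Lemma eval_alln v V A (P : M -> Prop) :
  (forall x, eval M (scons x v) V A <-> P x) -> (eval M v V (alln A) <-> forall x, P x).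
Proof. intros H; cbn; split; intros H' x; now apply H. Qed.

Lemma eval_exn v V A (P : M -> Prop) :
  (forall x, eval M (scons x v) V A <-> P x) -> (eval M v V (exn A) <-> exists x, P x).
Proof.
  intros H; cbn; split; intros H'.
  - apply NNPP; intros H''; apply H'; intros x Hx; apply H''; exists x; now apply H.
  - destruct H' as [x Hx]; intros H'; apply (H' x); now apply H.
Qed.

Lemma eval_alls v V A (P : nat -> Prop) :
  (forall X, eval M v (scons X V) A <-> P X) -> (eval M v V (alls A) <-> forall X, P X).
Proof. intros H; cbn; split; intros H' x; now apply H. Qed.

Lemma eval_exs v V A (P : nat -> Prop) :
  (forall X, eval M v (scons X V) A <-> P X) -> (eval M v V (exs A) <-> exists X, P X).
Proof.
  intros H; cbn; split; intros H'.
  - apply NNPP; intros H''; apply H'; intros X HX; apply H''; exists X; now apply H.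
  - destruct H' as [X HX]; intros H'; apply (H' X); now apply H.
Qed.

(** ** Definability *)

(** Variables [0], ..., [k - 1] are read off [v]; since the model is named, the
    remaining ones provide every element as a parameter. *)
Fixpoint ctx (k : nat) (v : nat -> M) : nat -> M :=
  match k with
  | O => var M
  | S k => scons (v O) (ctx k (fun n => v (S n)))
  end.

(** Definability is attached to Rocq functions and predicates of valuations, so that tactics can
    read off the complexity from the mathematical statement and no formula has to be written by
    hand. *)
Definition term_def (k : nat) (f : (nat -> M) -> M) : Prop :=
  exists t, forall v, eval_term M (ctx k v) t = f v.

Definition delta0 (k : nat) (P : (nat -> M) -> Prop) : Prop :=
  exists A, Delta00 A /\ forall v, eval M (ctx k v) (fun X => X) A <-> P v.

Definition sigma1 (k : nat) (P : (nat -> M) -> Prop) : Prop :=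
  exists A, Delta00 A /\
    forall v, (exists y, eval M (scons y (ctx k v)) (fun X => X) A) <-> P v.

Lemma term_def_shift k f :
  term_def k f -> term_def (S k) (fun v => f (fun n => v (S n))).
Proof. intros [t Ht]; exists (shift_term t); intros v; cbn; now rewrite eval_term_shift. Qed.

Lemma term_def_const k c : term_def k (fun _ => c).
Proof.
  induction k as [|k IH]; [|exact (term_def_shift k _ IH)].
  destruct (M_named c) as [t Ht]; now exists t.
Qed.

Lemma term_def_var k (n : nat) : (n < k)%nat -> term_def k (fun v => v n).
Proof.
  intros H; exists (tvar n); revert n H; induction k; intros n H v; [lia|].
  destruct n; cbn; [reflexivity|]; apply (IHk n (proj2 (Nat.succ_lt_mono _ _) H)).
Qed.

Lemma term_def_add k f g :
  term_def k f -> term_def k g -> term_def k (fun v => f v + g v).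
Proof. intros [s Hs] [t Ht]; exists (tadd s t); intros v; cbn; now rewrite Hs, Ht. Qed.

Lemma term_def_mul k f g :
  term_def k f -> term_def k g -> term_def k (fun v => f v * g v).
Proof. intros [s Hs] [t Ht]; exists (tmul s t); intros v; cbn; now rewrite Hs, Ht. Qed.

Lemma delta0_ext k P Q : (forall v, P v <-> Q v) -> delta0 k P -> delta0 k Q.
Proof. intros H [A [HA E]]; exists A; split; auto; intros v; now rewrite E. Qed.

Lemma delta0_eq k f g : term_def k f -> term_def k g -> delta0 k (fun v => f v = g v).
Proof.
  intros [s Hs] [t Ht]; exists (eqn s t); split; [constructor|].
  intros v; cbn; now rewrite Hs, Ht.
Qed.

Lemma delta0_lt k f g : term_def k f -> term_def k g -> delta0 k (fun v => f v < g v).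
Proof.
  intros [s Hs] [t Ht]; exists (ltn s t); split; [constructor|].
  intros v; cbn; now rewrite Hs, Ht.
Qed.

Lemma delta0_el k f X : term_def k f -> delta0 k (fun v => el M (f v) X).
Proof.
  intros [s Hs]; exists (mem s X); split; [constructor|].
  intros v; cbn; now rewrite Hs.
Qed.

Lemma delta0_imp k P Q : delta0 k P -> delta0 k Q -> delta0 k (fun v => P v -> Q v).
Proof.
  intros [A [HA EA]] [B [HB EB]]; exists (imp A B); split; [now constructor|].
  intros v; now apply eval_imp.
Qed.

Lemma delta0_not k P : delta0 k P -> delta0 k (fun v => ~ P v).
Proof.
  intros [A [HA EA]]; exists (neg A); split; [repeat constructor; auto|].
  intros v; now apply eval_neg.
Qed.

Lemma delta0_and k P Q : delta0 k P -> delta0 k Q -> delta0 k (fun v => P v /\ Q v).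
Proof.
  intros [A [HA EA]] [B [HB EB]]; exists (conj A B); split; [repeat constructor; auto|].
  intros v; now apply eval_conj.
Qed.

Lemma delta0_or k P Q : delta0 k P -> delta0 k Q -> delta0 k (fun v => P v \/ Q v).
Proof.
  intros [A [HA EA]] [B [HB EB]]; exists (disj A B); split; [repeat constructor; auto|].
  intros v; now apply eval_disj.
Qed.

Lemma delta0_all k f (Q : M -> (nat -> M) -> Prop) :
  term_def k f -> delta0 (S k) (fun v => Q (v O) (fun n => v (S n))) ->
  delta0 k (fun v => forall x, x < f v -> Q x v).
Proof.
  intros [t Ht] [A [HA EA]]; exists (alln (imp (ltn (tvar 0) (shift_term t)) A)).
  split; [now constructor|].
  intros v; apply eval_alln; intros x; apply eval_imp.
  - cbn; now rewrite eval_term_shift, Ht.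
  - apply (EA (scons x v)).
Qed.

Lemma delta0_ex k f (Q : M -> (nat -> M) -> Prop) :
  term_def k f -> delta0 (S k) (fun v => Q (v O) (fun n => v (S n))) ->
  delta0 k (fun v => exists x, x < f v /\ Q x v).
Proof.
  intros [t Ht] [A [HA EA]]; exists (exn (conj (ltn (tvar 0) (shift_term t)) A)).
  split; [now constructor|].
  intros v; apply eval_exn; intros x; apply eval_conj.
  - cbn; now rewrite eval_term_shift, Ht.
  - apply (EA (scons x v)).
Qed.

Lemma sigma1_ext k P Q : (forall v, P v <-> Q v) -> sigma1 k P -> sigma1 k Q.
Proof. intros H [A [HA E]]; exists A; split; auto; intros v; now rewrite E. Qed.

Lemma sigma1_delta0 k P : delta0 k P -> sigma1 k P.
Proof.
  intros [A [HA E]]; exists (shift_n A); split; [now apply Delta00_subst|].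
  intros v; unfold shift_n; rewrite <- E; split.
  - intros [y H]; now apply eval_subst in H.
  - intros H; exists 0; now apply eval_subst.
Qed.

Lemma sigma1_induction (P : M -> Prop) :
  sigma1 1 (fun v => P (v O)) ->
  P 0 -> (forall x, P x -> P (x + 1)) -> forall x, P x.
Proof.
  intros [A [HA E]] H0 HS.
  assert (E' : forall x v, v = scons x (var M) -> eval M v (fun X => X) (exn A) <-> P x).
  { intros x v ->; etransitivity; [|apply (E (fun _ => x))].
    now apply eval_exn. }
  pose proof (M_RCA0 _ (RCA0_induction _ (Sigma01_intro A HA))) as H.
  unfold holds in H; refine (proj1 (eval_imp _ _ _ _ (P 0 /\ forall x, P x -> P (x + 1)) (forall x, P x) _ _)
    H (Logic.conj H0 HS)).
  - apply eval_conj; [|apply eval_alln; intros x; apply eval_imp].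
    + unfold inst_n; rewrite eval_subst; apply (E' 0); extensionality n; now destruct n.
    + now apply E'.
    + unfold at_succ; rewrite eval_subst; apply (E' (x + 1)); extensionality n; now destruct n.
  - apply eval_alln; intros x; now apply E'.
Qed.

Lemma delta0_induction (P : M -> Prop) :
  delta0 1 (fun v => P (v O)) ->
  P 0 -> (forall x, P x -> P (x + 1)) -> forall x, P x.
Proof. intros H; now apply sigma1_induction, sigma1_delta0. Qed.

(** The Π01 formula required by the axiom is the negation of the Σ01 definition of the
    complement. *)
Lemma comprehension (P : M -> Prop) :
  sigma1 1 (fun v => P (v O)) -> sigma1 1 (fun v => ~ P (v O)) ->
  exists X, forall x, el M x X <-> P x.
Proof.
  intros [A [HA EA]] [B [HB EB]].
  assert (EA' : forall x, eval M (scons x (var M)) (fun X => X) (exn A) <-> P x).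
  { intros x; etransitivity; [|apply (EA (fun _ => x))].
    now apply eval_exn. }
  assert (HB' : Delta00 (neg B)) by (repeat constructor; auto).
  pose proof (M_RCA0 _ (RCA0_comprehension _ _ (Sigma01_intro A HA) (Pi01_intro _ HB')))
    as H.
  unfold holds in H; refine (proj1 (eval_imp _ _ _ _
    (forall x, P x <-> eval M (scons x (var M)) (fun X => X) (alln (neg B)))
    (exists X, forall x, el M x X <-> P x) _ _) H _).
  - apply eval_alln; intros x; apply eval_equi; [apply EA'|reflexivity].
  - apply eval_exs; intros X; apply eval_alln; intros x; apply eval_equi; [reflexivity|].
    unfold shift_s; rewrite eval_subst; apply EA'.
  - intros x; cbn; specialize (EB (fun _ => x)); cbn in EB.
    split.
    + intros H' y Hy; apply EB; [now exists y|exact H'].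
    + intros H'; apply NNPP; intros HP; apply EB in HP as [y Hy]; exact (H' y Hy).
Qed.

Lemma delta0_comprehension (P : M -> Prop) :
  delta0 1 (fun v => P (v O)) -> exists X, forall x, el M x X <-> P x.
Proof.
  intros H; apply comprehension; apply sigma1_delta0; auto; now apply delta0_not.
Qed.
Ltac term_def :=
  repeat first [apply term_def_const | apply term_def_var; lia
               | apply term_def_add | apply term_def_mul].

(** A hook for divisibility, which is equivalent to a bounded formula although its definition is not
    one. *)
Ltac delta0_atom := fail.

Ltac delta0 :=
  cbn beta;
  first [ apply delta0_all; [term_def|delta0] | apply delta0_ex; [term_def|delta0]
        | delta0_atom
        | apply delta0_not; delta0 | apply delta0_and; delta0 | apply delta0_or; delta0
        | apply delta0_eq; term_def | apply delta0_lt; term_def | apply delta0_el; term_def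
        | apply delta0_imp; delta0 ].

Ltac induct x := pattern x; revert x; apply delta0_induction; [delta0| |].

(** ** Arithmetic *)

Lemma succ_neq0 x : x + 1 <> 0.
Proof. exact (M_RCA0 _ RCA0_succ_neq0 x). Qed.

Lemma succ_inj x y : x + 1 = y + 1 -> x = y.
Proof. exact (M_RCA0 _ RCA0_succ_inj x y). Qed.

Lemma add0r x : x + 0 = x.
Proof. exact (M_RCA0 _ RCA0_add0 x). Qed.

Lemma addSr x y : x + (y + 1) = x + y + 1.
Proof. exact (M_RCA0 _ RCA0_addS x y). Qed.

Lemma mul0r x : x * 0 = 0.
Proof. exact (M_RCA0 _ RCA0_mul0 x). Qed.

Lemma mulSr x y : x * (y + 1) = x * y + x.
Proof. exact (M_RCA0 _ RCA0_mulS x y). Qed.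

Lemma lt0 x : ~ x < 0.
Proof. exact (M_RCA0 _ RCA0_lt0 x). Qed.

Lemma ltS x y : x < y + 1 <-> x < y \/ x = y.
Proof.
  refine (proj1 (eval_equi (scons y (scons x (var M))) (fun X => X)
    (ltn (tvar 1) (tadd (tvar 0) tone)) (disj (ltn (tvar 1) (tvar 0)) (eqn (tvar 1) (tvar 0)))
    _ _ _ _) (M_RCA0 _ RCA0_ltS x y)); [reflexivity|].
  apply eval_disj; reflexivity.
Qed.

Lemma add0l x : 0 + x = x.
Proof.
  induct x; [apply add0r|]; intros x IH; now rewrite addSr, IH.
Qed.

Lemma addSl x y : x + 1 + y = x + y + 1.
Proof.
  induct y; [now rewrite !add0r|]; intros y IH; now rewrite !addSr, IH.
Qed.

Lemma addC x y : x + y = y + x.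
Proof.
  induct y; [now rewrite add0r, add0l|]; intros y IH; now rewrite addSr, addSl, IH.
Qed.

Lemma addA x y z : x + (y + z) = x + y + z.
Proof.
  induct z; [now rewrite !add0r|]; intros z IH; now rewrite !addSr, IH.
Qed.

Lemma mul0l x : 0 * x = 0.
Proof.
  induct x; [apply mul0r|]; intros x IH; now rewrite mulSr, IH, add0r.
Qed.

Lemma mulSl x y : (x + 1) * y = x * y + y.
Proof.
  induct y; [now rewrite !mul0r, add0r|]; intros y IH.
  rewrite !mulSr, IH, !addSr, <- (addA _ y), (addC y x), addA; reflexivity.
Qed.

Lemma mulC x y : x * y = y * x.
Proof.
  induct y; [now rewrite mul0r, mul0l|]; intros y IH; now rewrite mulSr, mulSl, IH.
Qed.

Lemma mulDr x y z : x * (y + z) = x * y + x * z.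
Proof.
  induct z; [now rewrite mul0r, !add0r|]; intros z IH.
  now rewrite addSr, !mulSr, IH, addA.
Qed.

Lemma mulA x y z : x * (y * z) = x * y * z.
Proof.
  induct z; [now rewrite !mul0r|]; intros z IH; now rewrite !mulSr, mulDr, IH.
Qed.

Lemma mul1l x : 1 * x = x.
Proof. now rewrite mulC, <- (add0l 1), mulSr, mul0r, add0l. Qed.

Lemma semiring : semi_ring_theory 0 1 (add M) (mul M) eq.
Proof.
  split; auto using add0l, addC, addA, mul1l, mul0l, mulC, mulA.
  intros; rewrite !(mulC _ p), mulDr; reflexivity.
Qed.

Add Ring model_ring : semiring.

Lemma add_cancel x y z : x + z = y + z -> x = y.
Proof.
  induct z; [now rewrite !add0r|]; intros z IH; rewrite !addSr; intros H.
  now apply IH, succ_inj.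
Qed.

Lemma add_succ_neq x y : x + y + 1 <> x.
Proof.
  intros H; apply (succ_neq0 y), (add_cancel _ _ x); rewrite add0l; rewrite <- H at 2; ring.
Qed.

Lemma lt_iff x y : x < y <-> exists z, y = x + z + 1.
Proof.
  split.
  (* The witness is bounded because [induct] accepts only bounded formulas at this point. *)
  - enough (H : x < y -> exists z, z < y + 1 /\ y = x + z + 1)
      by (intros Hxy; destruct (H Hxy) as [z [_ Hz]]; now exists z).
    induct y; [intros H; now apply lt0 in H|].
    intros y IH H; apply ltS in H as [H| ->].
    + destruct (IH H) as [z [Hz E]]; exists (z + 1); split; [|rewrite E at 1; ring].
      assert (Hs : forall u w, u < w -> u + 1 < w + 1).
      { intros u w; induct w; [intros Hu; now apply lt0 in Hu|].
        intros w IHw Hu; apply ltS; apply ltS in Hu as [Hu| ->]; auto. }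
      now apply Hs.
    + exists 0; split; [|ring].
      assert (H0 : forall u, 0 < u + 1)
        by (intros u; induct u; [apply ltS; right; reflexivity|intros; apply ltS; now left]).
      apply H0.
  - intros [z ->]; induct z; [apply ltS; right; ring|].
    intros z IH; apply ltS; left; now rewrite addSr.
Qed.

Lemma lt_add x y : x < x + y + 1.
Proof. apply lt_iff; now exists y. Qed.

Lemma lt_irrefl x : ~ x < x.
Proof. rewrite lt_iff; intros [z H]; eapply add_succ_neq; eauto. Qed.

Lemma lt_trans x y z : x < y -> y < z -> x < z.
Proof.
  rewrite !lt_iff; intros [u ->] [w ->]; exists (u + w + 1); ring.
Qed.

Lemma zero_or_succ x : x = 0 \/ exists y, x = y + 1.
Proof.
  enough (H : x = 0 \/ exists y, y < x /\ x = y + 1)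
    by (destruct H as [H|[y [_ H]]]; eauto).
  induct x; [now left|].
  intros x _; right; exists x; split; auto; apply ltS; now right.
Qed.

Lemma trichotomy x y : x < y \/ x = y \/ y < x.
Proof.
  induct y.
  - destruct (zero_or_succ x) as [->|[z ->]]; auto.
    right; right; apply lt_iff; exists z; ring.
  - intros y [H|[->|H]].
    + left; apply ltS; auto.
    + left; apply ltS; auto.
    + apply lt_iff in H as [z ->]; destruct (zero_or_succ z) as [->|[w ->]].
      * right; left; ring.
      * right; right; apply lt_iff; exists w; ring.
Qed.

(** Throughout, the non-strict order is expressed by [y < x + 1]. *)
Lemma not_lt x y : ~ x < y -> y < x + 1.
Proof.
  intros H; apply ltS; destruct (trichotomy x y) as [H'|[H'|H']]; auto; tauto.
Qed.

Lemma lt_succ_trans x y z : x < y + 1 -> y < z -> x < z.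
Proof. rewrite ltS; intros [H| ->]; eauto using lt_trans. Qed.

Lemma lt_le_trans x y z : x < y -> y < z + 1 -> x < z.
Proof. rewrite ltS; intros H [H'| <-]; eauto using lt_trans. Qed.

Lemma lt_not_le x y : x < y -> ~ y < x + 1.
Proof. intros H H'; exact (lt_irrefl x (lt_le_trans x y x H H')). Qed.

Lemma lt_succ x : x < x + 1.
Proof. apply ltS; auto. Qed.

Lemma mul_eq0 x y : x * y = 0 -> x = 0 \/ y = 0.
Proof.
  destruct (zero_or_succ x) as [->|[u ->]]; auto.
  destruct (zero_or_succ y) as [->|[w ->]]; auto.
  intros H; exfalso; apply (succ_neq0 (u * w + u + w)); rewrite <- H; ring.
Qed.

Lemma least_number (P : M -> Prop) :
  delta0 1 (fun v => P (v O)) -> (exists x, P x) ->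
  exists x, P x /\ forall y, y < x -> ~ P y.
Proof.
  intros HD [x Hx]; apply NNPP; intros H.
  (* Replacing the abstract predicate by a set makes the induction formula visibly bounded. *)
  destruct (delta0_comprehension P HD) as [X HX].
  enough (Hn : forall x y, y < x -> ~ el M y X) by (apply (Hn (x + 1) x (lt_succ x)); now apply HX).
  clear x Hx; intros x; induct x; [intros y Hy; now apply lt0 in Hy|].
  intros x IH y Hy; apply ltS in Hy as [Hy| ->]; auto.
  intros Hx; apply H; exists x; split; [now apply HX|].
  intros y Hy Hy'; apply HX in Hy'; exact (IH y Hy Hy').
Qed.

Lemma ex_iff (P Q : M -> Prop) :
  (forall x, P x <-> Q x) -> (exists x, P x) <-> (exists x, Q x).
Proof. firstorder. Qed.

(** A pair of witnesses is bounded by a single one. *)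
Lemma sigma1_ex k (Q : M -> (nat -> M) -> Prop) :
  sigma1 (S k) (fun v => Q (v O) (fun n => v (S n))) ->
  sigma1 k (fun v => exists x, Q x v).
Proof.
  intros [A [HA E]].
  (* The renaming makes room for the common bound at index 2, behind the two bounded witnesses. *)
  set (sg := fun n => tvar (match n with O => O | S O => S O | S (S n) => S (S (S n)) end)).
  exists (exn (conj (ltn (tvar 0) (shift_term (tvar 0)))
         (exn (conj (ltn (tvar 0) (shift_term (tvar 1))) (subst sg (fun X => X) A))))).
  split; [apply Delta00_ex, Delta00_ex, Delta00_subst, HA|].
  intros v; transitivity (exists z x, x < z /\ exists y, y < z /\
    eval M (scons y (scons x (ctx k v))) (fun X => X) A).
  - apply ex_iff; intros z; apply eval_exn; intros x; apply eval_conj; [reflexivity|].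
    apply eval_exn; intros y; apply eval_conj; [reflexivity|].
    rewrite eval_subst.
    replace (fun n => eval_term M (scons y (scons x (scons z (ctx k v)))) (sg n))
      with (scons y (scons x (ctx k v))); [reflexivity|].
    extensionality n; destruct n as [|[|n]]; reflexivity.
  - split.
    + intros (z & x & _ & y & _ & H); exists x; apply (E (scons x v)); now exists y.
    + intros [x H]; apply (E (scons x v)) in H as [y H].
      exists (x + y + 1), x; split; [apply lt_add|].
      exists y; split; [rewrite (addC x); apply lt_add|exact H].
Qed.
(** ** Coding of finite sets *)

Definition dvd p x : Prop := exists q, p * q = x.

Lemma delta0_dvd k f g :
  term_def k f -> term_def k g -> delta0 k (fun v => dvd (f v) (g v)).
Proof.
  intros Hf Hg.
  apply delta0_ext with (fun v => exists q, q < g v + 1 /\ f v * q = g v).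
  - intros v; split; [intros (q & _ & H); now exists q|].
    (* If the divisor is zero, the given quotient can be arbitrarily large, and 0 replaces it. *)
    intros [q H]; destruct (zero_or_succ (f v)) as [E|[p E]].
    + exists 0; split; [rewrite <- (add0l (g v)); apply lt_add|].
      now rewrite <- H, E, !mul0l.
    + exists q; split; [|exact H].
      rewrite <- H, E; apply lt_iff; exists (p * q); ring.
  - apply delta0_ex; [apply term_def_add; [exact Hg|apply term_def_const]|].
    apply delta0_eq; [apply term_def_mul|]; try (now apply term_def_shift).
    apply term_def_var; lia.
Qed.

Ltac delta0_atom ::= apply delta0_dvd; term_def.

Ltac sigma1 := repeat apply sigma1_ex; apply sigma1_delta0; delta0.

(** From here on, induction statements may begin with unbounded existential quantifiers. *)
Ltac induct x ::= pattern x; revert x; apply sigma1_induction; [sigma1| |].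

Lemma dvd_mul_l p x y : dvd p x -> dvd p (x * y).
Proof. intros [q <-]; exists (q * y); ring. Qed.

Lemma add_eq0 x y : x + y = 0 -> y = 0.
Proof.
  destruct (zero_or_succ y) as [->|[z ->]]; auto.
  rewrite addSr; intros H; now apply succ_neq0 in H.
Qed.

Lemma dvd_add_cancel p x y : dvd p (x + y) -> dvd p x -> dvd p y.
Proof.
  intros [q Hq] [r Hr]; rewrite <- Hr in Hq.
  destruct (trichotomy r q) as [H|[->|H]].
  - apply lt_iff in H as [z ->]; exists (z + 1).
    apply (add_cancel _ _ (p * r)); rewrite (addC y), <- Hq; ring.
  - exists 0; rewrite mul0r; apply (add_cancel _ _ (p * q)).
    now rewrite (addC y), <- Hq, add0l.
  - apply lt_iff in H as [z ->].
    exists 0; rewrite mul0r; symmetry; apply (add_eq0 (p * (z + 1))).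
    apply (add_cancel _ _ (p * q)); rewrite add0l; rewrite Hq at 2; ring.
Qed.

(** A substitute for products defined by recursion: parameters (1, 0) give a stand-in for the
    factorial, and (b, b) a common multiple of the moduli. *)
Lemma common_multiple b c k :
  exists p, p <> 0 /\ forall x, x < k -> dvd (x * b + c + 1) p.
Proof.
  induct k.
  - exists 1; split; [rewrite <- (add0l 1); apply succ_neq0|].
    intros x Hx; now apply lt0 in Hx.
  - intros k [p [Hp H]]; exists (p * (k * b + c + 1)); split.
    + intros E; apply mul_eq0 in E as [E|E]; auto; now apply succ_neq0 in E.
    + intros x Hx; apply ltS in Hx as [Hx| ->]; [now apply dvd_mul_l, H|].
      exists p; ring.
Qed.

(** The moduli of Gödel's beta function. *)
Definition modulus b x : M := x * b + b + 1.

(** The moduli of distinct [i] and [j] differ by [b] times a divisor of [b],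
    while [b] is invertible modulo each of them. *)
Lemma modulus_coprime b k i j a :
  (forall d, d < k -> dvd (d + 1) b) -> i < k -> j < k -> i <> j ->
  dvd (modulus b i) (a * modulus b j) -> dvd (modulus b i) a.
Proof.
  intros Hb Hi Hj Hij H.
  (* Modulo [modulus b i] the number [i * b + b] is -1, hence can be cancelled. *)
  assert (Hinv : forall x, dvd (modulus b i) (x * (i * b + b)) -> dvd (modulus b i) x).
  { intros x; apply dvd_add_cancel; exists x; unfold modulus; ring. }
  assert (Hd : exists d, d < k /\ dvd (modulus b i) (a * (d + 1) * b)).
  { destruct (trichotomy i j) as [L|[E|L]]; [|contradiction|];
      apply lt_iff in L as [d E]; exists d; split.
    - eapply lt_trans; [|exact Hj]; apply lt_iff; exists i; rewrite E; ring.
    - apply dvd_add_cancel with (a * modulus b i); [|exists a; ring].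
      replace (a * modulus b i + a * (d + 1) * b) with (a * modulus b j); auto.
      rewrite E; unfold modulus; ring.
    - eapply lt_trans; [|exact Hi]; apply lt_iff; exists j; rewrite E; ring.
    - apply dvd_add_cancel with (a * modulus b j); [|exact H].
      exists a; rewrite E; unfold modulus; ring. }
  destruct Hd as [d [Hdk Hd]]; destruct (Hb d Hdk) as [u Hu].
  (* Inserting that factor twice yields two copies of [b]: one is rewritten as [(d + 1) * u], the
     other stays, and a multiple of [a * (d + 1) * b] results. *)
  apply Hinv, Hinv.
  replace (a * (i * b + b) * (i * b + b)) with (a * (d + 1) * b * (u * (i + 1) * (i + 1))).
  - now apply dvd_mul_l.
  - replace (a * (d + 1) * b * (u * (i + 1) * (i + 1)))
      with (a * b * ((d + 1) * u) * ((i + 1) * (i + 1))) by ring.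
    rewrite Hu; ring.
Qed.

Lemma modulus_gt1 b x : b <> 0 -> exists u, modulus b x = u + 1 + 1.
Proof.
  intros Hb; destruct (zero_or_succ b) as [->|[u ->]]; [now destruct Hb|].
  exists (x * (u + 1) + u); unfold modulus; ring.
Qed.

Lemma coprime_base k : exists b, b <> 0 /\ forall d, d < k -> dvd (d + 1) b.
Proof.
  destruct (common_multiple 1 0 k) as [b [Hb H]]; exists b; split; auto.
  intros d Hd; replace (d + 1) with (d * 1 + 0 + 1) by ring; auto.
Qed.

Definition coded a b x : Prop := dvd (modulus b x) a.

(** The code [a] is the product of the moduli of the elements of [X], collected by induction;
    coprimality keeps out all other numbers below [k]. The empty product 1 codes the empty set since
    [b <> 0] makes every modulus at least 2. *)
Lemma code_exists X k : exists a b, forall x, x < k -> (coded a b x <-> el M x X).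
Proof.
  destruct (coprime_base k) as [b [Hb0 Hb]].
  assert (H : forall j, exists a, forall x, x < k ->
    ((dvd (modulus b x) a -> x < j /\ el M x X) /\
     (x < j /\ el M x X -> dvd (modulus b x) a))).
  { intros j; induct j.
    - exists 1; intros x _; split; [|intros [H _]; now apply lt0 in H].
      intros [q Hq]; exfalso; destruct (modulus_gt1 b x Hb0) as [u E]; rewrite E in Hq.
      destruct (zero_or_succ q) as [->|[r ->]].
      + rewrite mul0r in Hq; apply (succ_neq0 0); now rewrite add0l.
      + apply (succ_neq0 (u * r + u + r + r)), succ_inj; rewrite add0l; etransitivity; [|exact Hq]; ring.
    - intros j [a Ha].
      destruct (classic (j < k /\ el M j X)) as [[Hjk Hj]|Hj].
      + exists (a * modulus b j); intros x Hx; destruct (classic (x = j)) as [->|Hxj].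
        * split; intros _; [split; auto using lt_succ|exists a; ring].
        * split.
          -- intros H; apply modulus_coprime with (k := k) in H; auto.
             apply Ha in H; auto; rewrite ltS; tauto.
          -- rewrite ltS; intros [[H| ->] HX]; [|contradiction].
             apply dvd_mul_l, Ha; auto.
      + exists a; intros x Hx; rewrite ltS; split.
        * intros H; apply Ha in H; auto; tauto.
        * intros [[H| ->] HX]; [apply Ha; auto|tauto]. }
  destruct (H k) as [a Ha]; exists a, b; intros x Hx; unfold coded.
  split; intros H'; apply Ha; auto; tauto.
Qed.

(** ** Pairs and functions *)

Definition pr x y : M := (x + y) * (x + y) + x.

Lemma lt_add_mono x y z w : x < y + 1 -> z < w + 1 -> x + z < y + w + 1.
Proof.
  intros H H'; apply lt_iff in H as [u E], H' as [t E'].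
  apply succ_inj in E, E'; subst; apply lt_iff; exists (u + t); ring.
Qed.

Lemma lt_mul_mono x y z w : x < y + 1 -> z < w + 1 -> x * z < y * w + 1.
Proof.
  intros H H'; apply lt_iff in H as [u E], H' as [t E'].
  apply succ_inj in E, E'; subst; apply lt_iff; exists (u * z + x * t + u * t); ring.
Qed.

Lemma pr_mono x y z w : x < z + 1 -> y < w + 1 -> pr x y < pr z w + 1.
Proof. unfold pr; auto using lt_add_mono, lt_mul_mono. Qed.

(** The pair lies between the squares of [x + y] and [x + y + 1], so it determines the sum, and then
    [x]. *)
Lemma pr_inj x y z w : pr x y = pr z w -> x = z /\ y = w.
Proof.
  assert (Hlt : forall a b c d, a + b < c + d -> pr a b <> pr c d).
  { intros a b c d H E; apply lt_iff in H as [u H]; unfold pr in E; rewrite H in E.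
    apply (add_succ_neq ((a + b) * (a + b) + a)
      (a + b + b + (u + u) * (a + b) + u * u + u + u + c)).
    rewrite E at 2; ring. }
  intros E; destruct (trichotomy (x + y) (z + w)) as [H|[H|H]].
  - destruct (Hlt _ _ _ _ H E).
  - unfold pr in E; rewrite H in E; rewrite (addC _ x), (addC _ z) in E.
    apply add_cancel in E as ->; split; auto.
    apply (add_cancel _ _ z); now rewrite (addC y), (addC w).
  - destruct (Hlt _ _ _ _ H (eq_sym E)).
Qed.

(** Components bounded by the pair make decoding a bounded search. *)
Lemma pr_lt_l x y : x < pr x y + 1.
Proof. apply lt_iff; exists ((x + y) * (x + y)); unfold pr; ring. Qed.

Lemma pr_lt_r x y : y < pr x y + 1.
Proof.
  unfold pr; apply lt_iff; destruct (zero_or_succ (x + y)) as [E|[u E]].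
  - apply add_eq0 in E as E'; subst y; rewrite E, mul0r; exists x; ring.
  - exists (u * (x + y) + x + x); rewrite E at 1; ring.
Qed.

Definition maps F x y : Prop := el M (pr x y) F.

Definition is_relation R : Prop := forall x, el M x R -> exists y z, x = pr y z.

Definition is_function F : Prop :=
  is_relation F /\
  forall x, exists y, maps F x y /\ forall z, maps F x z -> z = y.

Lemma maps_unique F x y z : is_function F -> maps F x y -> maps F x z -> y = z.
Proof.
  intros [_ HF] Hy Hz; destruct (HF x) as [u [_ H]].
  now rewrite (H _ Hy), (H _ Hz).
Qed.

(** Values are certified by codes of finite computations. Since [N] strictly increases its argument,
    the last value of a computation bounds all earlier ones, which keeps the certificate condition
    bounded. *)
Lemma iteration N s :
  (forall x, exists y, x < y /\ maps N x y /\ forall z, maps N x z -> z = y) ->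
  exists F, is_function F /\ maps F 0 s /\
    forall i x y, maps F i x -> maps N x y -> maps F (i + 1) y.
Proof.
  intros HN.
  (* A computation is read backwards: every coded pair in the box up to [(n, h)] is the start or has
     a coded predecessor. *)
  set (seq := fun a b n h => coded a b (pr n h) /\
    forall i, i < n + 1 -> forall y, y < h + 1 -> coded a b (pr i y) ->
      (i = 0 /\ y = s) \/
      exists j, j < i /\ exists x, x < y /\
        i = j + 1 /\ coded a b (pr j x) /\ maps N x y).
  assert (Huniq : forall n a b h a' b' h', seq a b n h -> seq a' b' n h' -> h = h').
  { intros n a b h a' b' h' [Hn H] [Hn' H'].
    enough (Hi : forall i, i < n + 1 -> forall y, y < h + 1 -> forall y', y' < h' + 1 ->
      coded a b (pr i y) -> coded a' b' (pr i y') -> y = y')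
      by (apply (Hi n); auto using lt_succ).
    intros i; induct i.
    - intros Hi y Hy y' Hy' Hc Hc'.
      destruct (H _ Hi _ Hy Hc) as [[_ ->]|(j & Hj & _)]; [|now apply lt0 in Hj].
      destruct (H' _ Hi _ Hy' Hc') as [[_ ->]|(j & Hj & _)]; [auto|now apply lt0 in Hj].
    - intros i IH Hi y Hy y' Hy' Hc Hc'.
      destruct (H _ Hi _ Hy Hc) as [[E _]|(j & _ & x & Hx & E & Hcx & HNx)];
        [now apply succ_neq0 in E|apply succ_inj in E; subst j].
      destruct (H' _ Hi _ Hy' Hc') as [[E _]|(j & _ & x' & Hx' & E & Hcx' & HNx')];
        [now apply succ_neq0 in E|apply succ_inj in E; subst j].
      assert (E : x = x').
      { apply IH; auto.
        - eapply lt_trans; [apply lt_succ|exact Hi].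
        - eapply lt_trans; eauto.
        - eapply lt_trans; eauto. }
      subst x'; destruct (HN x) as (z & _ & _ & Hz).
      now rewrite (Hz _ HNx), (Hz _ HNx'). }
  assert (Hbase : exists a b, seq a b 0 s).
  { destruct (delta0_comprehension (fun z => z = pr 0 s)) as [X HX]; [delta0|].
    destruct (code_exists X (pr 0 s + 1)) as (a & b & Hc); exists a, b; split.
    - apply Hc, HX; auto using lt_succ.
    - intros i Hi y Hy H; left; apply Hc, HX, pr_inj in H; auto using pr_mono. }
  assert (Hstep : forall n h y, (exists a b, seq a b n h) -> maps N h y ->
    exists a b, seq a b (n + 1) y).
  { intros n h y (a & b & Hnh & H) Hy.
    assert (Hhy : h < y)
      by (destruct (HN h) as (z & Hz & _ & E); now rewrite (E _ Hy)).
    (* The old code is cut down to its box before the new pair is added, since nothing is known of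
       its elements outside. *)
    destruct (delta0_comprehension (fun z => z = pr (n + 1) y \/ (coded a b z /\
      exists i, i < n + 1 /\ exists u, u < h + 1 /\ z = pr i u))) as [X HX]; [delta0|].
    destruct (code_exists X (pr (n + 1) y + 1)) as (a' & b' & Hc); exists a', b'.
    assert (Hold : forall i u, i < n + 1 -> u < h + 1 -> coded a b (pr i u) ->
      coded a' b' (pr i u)).
    { intros i u Hi Hu Hiu; apply Hc.
      - apply pr_mono; [apply ltS; now left|].
        eapply lt_trans; [exact (lt_succ_trans _ _ _ Hu Hhy)|apply lt_succ].
      - apply HX; right; split; [auto|]; exists i; split; [auto|]; now exists u. }
    split; [apply Hc; [apply lt_succ|apply HX; now left]|].
    intros i Hi u Hu Hiu; apply Hc, HX in Hiu; [|now apply pr_mono].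
    destruct Hiu as [E|(Hiu & i' & Hi' & u' & Hu' & E)].
    - apply pr_inj in E as [-> ->]; right.
      exists n; split; [apply lt_succ|]; exists h; repeat split; auto using lt_succ.
    - apply pr_inj in E as [<- <-].
      destruct (H i Hi' u Hu' Hiu) as [E|(j & Hj & x & Hx & E & Hjx & HNx)]; [now left|right].
      exists j; split; [auto|]; exists x; repeat split; auto.
      apply Hold; auto; eapply lt_trans; eauto. }
  assert (Htotal : forall n, exists h a b, seq a b n h).
  { intros n; induct n; [now exists s|].
    intros n [h Hh]; destruct (HN h) as (y & _ & Hy & _).
    exists y; now apply Hstep with h. }
  destruct (comprehension (fun z => exists n h a b, z = pr n h /\ seq a b n h)) as [F HF].
  - sigma1.
  (* A number is outside the graph iff it is no pair or some computation of the same length ends in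
     another value. *)
  - apply sigma1_ext with (fun v => exists n h' a b,
      (forall n, n < v O + 1 -> forall h, h < v O + 1 -> v O <> pr n h) \/
      (exists h, h < v O + 1 /\ v O = pr n h /\ h <> h' /\ seq a b n h')); [|sigma1].
    intros v; split.
    + intros (n & h' & a & b & [H|(h & _ & E & Hne & H)]) (n' & h'' & a' & b' & E' & H').
      * eapply H; [| |exact E']; rewrite E'; [apply pr_lt_l|apply pr_lt_r].
      * rewrite E in E'; apply pr_inj in E' as [<- <-]; apply Hne; eauto.
    + intros H.
      destruct (classic (exists n h, v O = pr n h)) as [(n & h & E)|Hp].
      * destruct (Htotal n) as (h' & a & b & Hs); exists n, h', a, b; right.
        exists h; rewrite E; split; [apply pr_lt_r|]; split; [auto|]; split; [|exact Hs].
        intros ->; apply H; exists n, h', a, b; auto.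
      * exists 0, 0, 0, 0; left; intros n _ h _ E; apply Hp; eauto.
  - assert (HF' : forall n h, maps F n h <-> exists a b, seq a b n h).
    { intros n h; unfold maps; rewrite HF; split.
      - intros (n' & h' & a & b & E & H); apply pr_inj in E as [-> ->]; eauto.
      - intros (a & b & H); exists n, h, a, b; auto. }
    exists F; repeat split.
    + intros z Hz; apply HF in Hz as (n & h & _ & _ & E & _); eauto.
    + intros n; destruct (Htotal n) as (h & a & b & Hs); exists h; split.
      * apply HF'; eauto.
      * intros z Hz; apply HF' in Hz as (a' & b' & Hz); eauto.
    + now apply HF'.
    + intros i x y; rewrite !HF'; eauto.
Qed.

(** * Enumerations, unboundedness and increasing subsequences *)

Lemma least_above X x :
  (exists y, x < y /\ el M y X) ->
  exists y, (x < y /\ el M y X) /\ forall z, z < y -> ~ (x < z /\ el M z X).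
Proof. apply (least_number (fun y => x < y /\ el M y X)); delta0. Qed.

Lemma le_trans x y z : x < y + 1 -> y < z + 1 -> x < z + 1.
Proof. apply lt_succ_trans. Qed.

Definition is_infinite X : Prop := forall x, exists y, x < y /\ el M y X.

(** Iterates the map from a number to the least larger element of [H]; minimality is a bounded
    condition, so the graph of this map exists. *)
Lemma enumeration H : is_infinite H ->
  exists F, is_function F /\ (forall i x, maps F i x -> el M x H) /\
    (forall i j x y, i < j -> maps F i x -> maps F j y -> x < y).
Proof.
  intros HH.
  destruct (delta0_comprehension (fun z => exists x, x < z + 1 /\ exists y, y < z + 1 /\
    z = pr x y /\ (x < y /\ el M y H) /\ forall u, u < y -> ~ (x < u /\ el M u H)))
    as [N HN]; [delta0|].
  assert (HN' : forall x y, maps N x y <->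
    (x < y /\ el M y H) /\ forall u, u < y -> ~ (x < u /\ el M u H)).
  { intros x y; unfold maps; rewrite HN; split.
    - intros (x' & _ & y' & _ & E & Hxy); apply pr_inj in E as [-> ->]; exact Hxy.
    - intros Hxy; exists x; split; [apply pr_lt_l|]; exists y; split; [apply pr_lt_r|].
      split; [reflexivity|exact Hxy]. }
  assert (Hnext : forall x, exists y, x < y /\ maps N x y /\ forall z, maps N x z -> z = y).
  { intros x; destruct (least_above H x (HH x)) as (y & Hxy & Hmin); exists y.
    split; [apply Hxy|]; split; [now apply HN'|].
    intros z Hz; apply HN' in Hz as [Hz Hz'].
    destruct (trichotomy z y) as [L|[E|L]]; [destruct (Hmin _ L Hz)|exact E|].
    destruct (Hz' _ L Hxy). }
  destruct (HH 0) as (s & _ & Hs).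
  destruct (iteration N s Hnext) as (F & HF & HF0 & HFS); exists F; split; [exact HF|].
  assert (Hstep : forall i x, maps F i x -> exists y, maps F (i + 1) y /\ x < y /\ el M y H).
  { intros i x Hix; destruct (Hnext x) as (y & Hxy & Hy & _); exists y.
    split; [now apply HFS with x|]; split; [exact Hxy|]; now apply HN' in Hy. }
  split.
  - intros i x Hix.
    (* A claim about all values of [F] at [i] would be universal; by uniqueness of values it
       suffices to exhibit one, which is a Σ01 statement. *)
    enough (Hi : exists y, maps F i y /\ el M y H)
      by (destruct Hi as (y & Hiy & Hy); now rewrite (maps_unique F i x y HF Hix Hiy)).
    clear x Hix; induct i; [now exists s|].
    intros i (y & Hiy & _); destruct (Hstep i y Hiy) as (z & Hz & _ & Hz'); eauto.
  - intros i j x y Hij Hx Hy; apply lt_iff in Hij as [d ->].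
    enough (Hd : exists z, maps F (i + d + 1) z /\ x < z)
      by (destruct Hd as (z & Hz & Hxz); now rewrite (maps_unique F _ y z HF Hy Hz)).
    clear y Hy; induct d.
    + destruct (Hstep i x Hx) as (z & Hz & Hxz & _); exists z; now rewrite add0r.
    + intros d (z & Hz & Hxz); destruct (Hstep _ z Hz) as (w & Hw & Hzw & _); exists w.
      rewrite addSr; split; [exact Hw|]; eapply lt_trans; eauto.
Qed.

Lemma increasing_ge F : is_function F ->
  (forall i j x y, i < j -> maps F i x -> maps F j y -> x < y) ->
  forall i x, maps F i x -> i < x + 1.
Proof.
  intros HF Hinc i x Hix.
  enough (Hi : exists y, maps F i y /\ i < y + 1)
    by (destruct Hi as (y & Hiy & Hy); now rewrite (maps_unique F i x y HF Hix Hiy)).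
  clear x Hix; induct i.
  - destruct HF as [_ HF]; destruct (HF 0) as (y & Hy & _); exists y; split; auto.
    apply lt_iff; exists y; ring.
  - intros i (y & Hy & Hiy); pose proof HF as [_ HF'].
    destruct (HF' (i + 1)) as (z & Hz & _); exists z; split; auto.
    pose proof (Hinc _ _ _ _ (lt_succ i) Hy Hz) as Hyz.
    apply lt_iff in Hyz as [u ->]; apply lt_iff in Hiy as [t E].
    apply lt_iff; exists (t + u); transitivity ((y + 1) + u + 1); [ring|rewrite E; ring].
Qed.

(** If all values were at most [k], the product of the moduli of the first [n]
    values would exceed [n] but divide a fixed nonzero number. *)
Lemma injective_unbounded F : is_function F ->
  (forall i j x, maps F i x -> maps F j x -> i = j) ->
  forall k, exists i x, maps F i x /\ k < x.
Proof.
  intros HF Hinj k; apply NNPP; intros Hk.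
  assert (Hb : forall i x, maps F i x -> x < k + 1).
  { intros i x Hx; apply not_lt; intros L; apply Hk; eauto. }
  destruct (coprime_base (k + 1)) as [b [Hb0 Hdiv]].
  destruct (common_multiple b b (k + 1)) as [p [Hp Hmul]].
  (* Here [a] is the product of the moduli of the first [n] values, and the cofactor [c] is still
     divisible by the modulus of every value not yet used. *)
  assert (Hprod : forall n, exists a c, a * c = p /\ n < a /\
    forall x, x < k + 1 -> (forall i, i < n -> ~ maps F i x) -> dvd (modulus b x) c).
  { intros n; unfold modulus, maps, pr; induct n.
    - exists 1, p; split; [apply mul1l|]; split; [rewrite <- (add0l 1); apply lt_succ|].
      intros x Hx _; now apply Hmul.
    - intros n (a & c & Hac & Hna & Hc).
      pose proof HF as [_ HF']; destruct (HF' n) as (x & Hx & _).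
      destruct (Hc x (Hb _ _ Hx)) as [c' Hc'].
      { intros i Hi Hix; rewrite (Hinj _ _ _ Hix Hx) in Hi; exact (lt_irrefl _ Hi). }
      exists (a * modulus b x), c'; split; [rewrite <- Hac, <- Hc'; unfold modulus; ring|]; split.
      + destruct (modulus_gt1 b x Hb0) as [u E]; unfold modulus in E |- *; rewrite E.
        apply lt_iff in Hna as [e ->]; apply lt_iff.
        exists ((n + e + 1) * u + n + e + e); ring.
      + intros y Hy Hny.
        assert (Hyc : dvd (modulus b y) c).
        { apply Hc; auto; intros i Hi; apply Hny, ltS; now left. }
        apply modulus_coprime with (k := k + 1) (j := x); auto.
        * eapply Hb; exact Hx.
        * intros ->; exact (Hny n (lt_succ n) Hx).
        * rewrite <- Hc' in Hyc; now rewrite mulC. }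
  (* After [p] steps a divisor of the nonzero [p] would exceed [p]. *)
  destruct (Hprod p) as (a & c & E & Hpa & _).
  destruct (zero_or_succ c) as [->|[d ->]]; [now rewrite mul0r in E; apply Hp|].
  apply (lt_irrefl p), (lt_le_trans _ a); [exact Hpa|].
  apply lt_iff; exists (a * d); rewrite <- E; ring.
Qed.

(** The intermediate value is an unbounded witness; totality and uniqueness of values make the
    complement Σ01 as well. *)
Lemma composition F G : is_function F -> is_function G ->
  exists K, is_function K /\ forall i x y, maps F i x -> maps G x y -> maps K i y.
Proof.
  intros HF HG.
  assert (Htotal : forall i, exists x y, maps F i x /\ maps G x y).
  { intros i; destruct HF as [_ HF], HG as [_ HG]; destruct (HF i) as (x & Hx & _).
    destruct (HG x) as (y & Hy & _); eauto. }
  assert (Huniq : forall i x x' y y', maps F i x -> maps G x y -> maps F i x' ->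
    maps G x' y' -> y = y').
  { intros i x x' y y' Hx Hy Hx' Hy'; rewrite (maps_unique F i x x' HF Hx Hx') in Hy.
    eapply maps_unique; eauto. }
  destruct (comprehension (fun z => exists i x y, z = pr i y /\ maps F i x /\ maps G x y))
    as [K HK].
  - sigma1.
  - apply sigma1_ext with (fun v => exists i x y,
      (forall i, i < v O + 1 -> forall y, y < v O + 1 -> v O <> pr i y) \/
      (exists y', y' < v O + 1 /\ v O = pr i y' /\ y' <> y /\ maps F i x /\ maps G x y));
      [|sigma1].
    intros v; split.
    + intros (i & x & y & [H|(y' & _ & E & Hne & Hx & Hy)]) (i' & x' & y'' & E' & Hx' & Hy').
      * eapply H; [| |exact E']; rewrite E'; [apply pr_lt_l|apply pr_lt_r].
      * rewrite E in E'; apply pr_inj in E' as [<- <-]; eauto.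
    + intros H; destruct (classic (exists i y, v O = pr i y)) as [(i & y & E)|Hp].
      * destruct (Htotal i) as (x & y' & Hx & Hy); exists i, x, y'; right.
        exists y; rewrite E; repeat split; auto using pr_lt_r.
        intros ->; apply H; exists i, x, y'; auto.
      * exists 0, 0, 0; left; intros i _ y _ E; apply Hp; eauto.
  - assert (HK' : forall i y, maps K i y <-> exists x, maps F i x /\ maps G x y).
    { intros i y; unfold maps at 1; rewrite HK; split.
      - intros (i' & x & y' & E & H); apply pr_inj in E as [-> ->]; eauto.
      - intros (x & H); exists i, x, y; auto. }
    exists K; repeat split.
    + intros z Hz; apply HK in Hz as (i & _ & y & E & _); eauto.
    + intros i; destruct (Htotal i) as (x & y & Hx & Hy); exists y; split.
      * apply HK'; eauto.
      * intros z Hz; apply HK' in Hz as (x' & Hx' & Hz); eauto.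
    + intros i x y; rewrite HK'; eauto.
Qed.

(** The range of [F] need not exist as a set, but the set of its record values
    does: a non-record is refuted by a larger record. *)
Lemma increasing_subsequence F : is_function F ->
  (forall k, exists i x, maps F i x /\ k < x) ->
  exists H, is_infinite H /\ forall x y, el M x H -> el M y H -> x < y ->
    exists i j, i < j /\ maps F i x /\ maps F j y.
Proof.
  intros HF Hunb.
  set (record := fun i x => maps F i x /\ forall j, j < i -> exists y, y < x /\ maps F j y).
  assert (Hinf : forall k, exists i x, record i x /\ k < x).
  { intros k.
    (* The first index whose value exceeds [k] carries a record. *)
    destruct (least_number (fun i => ~ exists x, x < k + 1 /\ maps F i x))
      as (i & Hi & Hmin); [delta0| |].
    - destruct (Hunb k) as (i & x & Hx & Hkx); exists i; intros (y & Hy & Hiy).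
      rewrite (maps_unique F i y x HF Hiy Hx) in Hy; exact (lt_not_le _ _ Hkx Hy).
    - pose proof HF as [_ HF']; destruct (HF' i) as (x & Hx & _).
      assert (Hkx : k < x).
      { destruct (trichotomy k x) as [L|[E|L]]; [exact L| |]; destruct Hi; exists x;
          rewrite ltS; auto. }
      exists i, x; repeat split; auto.
      intros j Hj; apply Hmin in Hj; apply NNPP in Hj as (y & Hy & Hjy).
      exists y; split; [eapply lt_succ_trans; eauto|exact Hjy]. }
  assert (Hord : forall i j x y, record i x -> record j y -> x < y -> i < j).
  { intros i j x y [Hi Hi'] [Hj Hj'] L; destruct (trichotomy i j) as [?|[->|Hji]]; auto.
    - rewrite (maps_unique F j x y HF Hi Hj) in L; now apply lt_irrefl in L.
    - destruct (Hi' j Hji) as (z & Hz & Hjz); rewrite (maps_unique F j z y HF Hjz Hj) in Hz.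
      destruct (lt_irrefl x); eapply lt_trans; eauto. }
  destruct (comprehension (fun x => exists i, record i x)) as [H HH].
  - sigma1.
  (* Records with smaller values occur earlier, so below a larger record at [i] only indices less
     than [i] have to be searched. *)
  - apply sigma1_ext with (fun v => exists i x, record i x /\ v O < x /\
      forall j, j < i -> ~ record j (v O)); [|sigma1].
    intros v; split.
    + intros (i & x & Hx & L & Hno) [j Hj]; exact (Hno j (Hord _ _ _ _ Hj Hx L) Hj).
    + intros Hno; destruct (Hinf (v O)) as (i & x & Hx & L); exists i, x.
      split; [exact Hx|]; split; [exact L|]; intros j _ Hj; apply Hno; now exists j.
  - exists H; split.
    + intros k; destruct (Hinf k) as (i & x & Hx & L); exists x; rewrite HH; eauto.
    + intros x y Hx Hy L; apply HH in Hx as [i Hi], Hy as [j Hj]; exists i, j.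
      split; [now apply (Hord i j x y)|]; split; [apply Hi|apply Hj].
Qed.
(** ** The combinatorial principles *)

Definition is_linear_order L : Prop :=
  is_relation L /\ (forall x, ~ maps L x x) /\
  (forall x y z, maps L x y /\ maps L y z -> maps L x z) /\
  (forall x y, x <> y -> maps L x y \/ maps L y x).

Definition is_ascending L F : Prop :=
  forall i j, i < j -> forall x y, maps F i x /\ maps F j y -> maps L x y.

Definition is_descending L F : Prop :=
  forall i j, i < j -> forall x y, maps F i x /\ maps F j y -> maps L y x.

Definition colored C x y c : Prop := el M (pr (pr x y) c) C.

Definition is_coloring C : Prop :=
  (forall z, el M z C -> exists x y c, x < y /\ (c = 0 \/ c = 1) /\ z = pr (pr x y) c) /\
  (forall x y, x < y -> exists c, (c = 0 \/ c = 1) /\ colored C x y c /\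
    forall d, colored C x y d -> d = c).

Definition is_homogeneous C H : Prop :=
  exists c, forall x y, el M x H /\ el M y H /\ x < y -> colored C x y c.

Definition is_tournament T : Prop :=
  is_relation T /\ (forall x, ~ maps T x x) /\
  (forall x y, x <> y -> (maps T x y /\ ~ maps T y x) \/ (maps T y x /\ ~ maps T x y)).

Definition is_transitive_on T S : Prop :=
  forall x y z, el M x S /\ el M y S /\ el M z S ->
    maps T x y /\ maps T y z -> maps T x z.

Definition model_RT22 : Prop :=
  forall C, is_coloring C -> exists H, is_infinite H /\ is_homogeneous C H.

Definition model_ADS : Prop :=
  forall L, is_linear_order L ->
    exists F, is_function F /\ (is_ascending L F \/ is_descending L F).

Definition model_EM : Prop :=
  forall T, is_tournament T -> exists S, is_infinite S /\ is_transitive_on T S.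

Ltac reify :=
  lazymatch goal with
  | |- eval _ _ _ (conj _ _) <-> _ => apply eval_conj; reify
  | |- eval _ _ _ (disj _ _) <-> _ => apply eval_disj; reify
  | |- eval _ _ _ (exn _) <-> _ => apply eval_exn; intros; reify
  | |- eval _ _ _ (exs _) <-> _ => apply eval_exs; intros; reify
  | |- eval _ _ _ (neg _) <-> _ => apply eval_neg; reify
  | |- eval _ _ _ (imp _ _) <-> _ => apply eval_imp; reify
  | |- eval _ _ _ (alln _) <-> _ => apply eval_alln; intros; reify
  | |- eval _ _ _ (alls _) <-> _ => apply eval_alls; intros; reify
  | |- _ => reflexivity
  end.

Lemma holds_RT22 : holds M RT22 <-> model_RT22.
Proof. unfold holds, RT22, coloring, infinite, homogeneous; reify. Qed.

Lemma holds_ADS : holds M ADS <-> model_ADS.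
Proof.
  unfold holds, ADS, linear_order, function, relation, ascending, descending; reify.
Qed.

Lemma holds_EM : holds M EM <-> model_EM.
Proof. unfold holds, EM, tournament, relation, infinite, transitive_on; reify. Qed.

Lemma one_neq0 : 1 <> 0.
Proof. rewrite <- (add0l 1); apply succ_neq0. Qed.

Lemma RT22_ADS : model_RT22 -> model_ADS.
Proof.
  intros HRT L (HL & Hirr & Htrans & Htot).
  destruct (delta0_comprehension (fun z => exists x, x < z + 1 /\ exists y, y < z + 1 /\
    x < y /\ ((z = pr (pr x y) 1 /\ maps L x y) \/ (z = pr (pr x y) 0 /\ ~ maps L x y))))
    as [C HC]; [unfold maps; delta0|].
  assert (HC' : forall x y c, colored C x y c <->
    x < y /\ ((c = 1 /\ maps L x y) \/ (c = 0 /\ ~ maps L x y))).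
  { intros x y c; unfold colored; rewrite HC; split.
    - intros (x' & _ & y' & _ & Hxy & [[E H]|[E H]]); apply pr_inj in E as [E ->];
        apply pr_inj in E as [-> ->]; tauto.
    - intros [Hxy H]; exists x; split; [eapply le_trans; [apply pr_lt_l|apply pr_lt_l]|].
      exists y; split; [eapply le_trans; [apply pr_lt_r|apply pr_lt_l]|].
      split; [exact Hxy|]; destruct H as [[-> H]|[-> H]]; auto. }
  destruct (HRT C) as (H & HH & c & Hc).
  { split.
    - intros z Hz; apply HC in Hz as (x & _ & y & _ & Hxy & [[E _]|[E _]]);
        exists x, y; eauto.
    - intros x y Hxy; destruct (classic (maps L x y)) as [HL'|HL'].
      + exists 1; split; [now right|]; split; [apply HC'; auto|].
        intros d Hd; apply HC' in Hd; tauto.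
      + exists 0; split; [now left|]; split; [apply HC'; auto|].
        intros d Hd; apply HC' in Hd; tauto. }
  destruct (enumeration H HH) as (F & HF & HFH & Hinc); exists F; split; [exact HF|].
  assert (Hcol : forall i j x y, i < j -> maps F i x /\ maps F j y ->
    x < y /\ ((c = 1 /\ maps L x y) \/ (c = 0 /\ ~ maps L x y))).
  { intros i j x y Hij [Hx Hy]; apply HC', Hc; repeat split; eauto. }
  destruct (classic (c = 1)) as [->|Hc1]; [left|right]; intros i j Hij x y Hxy.
  - destruct (Hcol i j x y Hij Hxy) as [_ [[_ HL']|[E _]]]; auto; now apply one_neq0 in E.
  - destruct (Hcol i j x y Hij Hxy) as [Lxy [[E _]|[_ HL']]]; [contradiction|].
    destruct (Htot x y) as [?|?]; auto; [|contradiction].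
    intros ->; exact (lt_irrefl _ Lxy).
Qed.

Lemma EM_ADS_RT22 : model_EM -> model_ADS -> model_RT22.
Proof.
  intros HEM HADS C [_ HC].
  destruct (delta0_comprehension (fun z => exists x, x < z + 1 /\ exists y, y < z + 1 /\
    z = pr x y /\ ((x < y /\ colored C x y 1) \/ (y < x /\ ~ colored C y x 1))))
    as [T HT]; [unfold colored; delta0|].
  assert (HT' : forall x y, maps T x y <->
    (x < y /\ colored C x y 1) \/ (y < x /\ ~ colored C y x 1)).
  { intros x y; unfold maps; rewrite HT; split.
    - intros (x' & _ & y' & _ & E & H); apply pr_inj in E as [-> ->]; exact H.
    - intros H; exists x; split; [apply pr_lt_l|]; exists y; split; [apply pr_lt_r|]; auto. }
  assert (Hlt : forall x y, x < y -> (maps T x y <-> colored C x y 1) /\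
    (maps T y x <-> ~ colored C x y 1)).
  { intros x y Hxy; rewrite !HT'; assert (~ y < x)
      by (intros Hyx; exact (lt_irrefl x (lt_trans _ _ _ Hxy Hyx))); tauto. }
  assert (Hirr : forall x, ~ maps T x x).
  { intros x; rewrite HT'; intros [[H _]|[H _]]; exact (lt_irrefl _ H). }
  assert (Htot : forall x y, x <> y ->
    (maps T x y /\ ~ maps T y x) \/ (maps T y x /\ ~ maps T x y)).
  { intros x y Hxy; destruct (trichotomy x y) as [H|[E|H]]; [|contradiction|];
      apply Hlt in H as [H1 H2]; rewrite H1, H2; tauto. }
  destruct (HEM T) as (S & HS & HST).
  { split; [|auto]; intros z Hz; apply HT in Hz as (x & _ & y & _ & E & _); eauto. }
  destruct (enumeration S HS) as (e & He & HeS & Hinc).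
  (* [L] is the tournament on [S] pulled back along the enumeration [e], since ADS speaks only of
     orders with domain N. *)
  destruct (comprehension (fun z => exists i j x y, z = pr i j /\
    maps e i x /\ maps e j y /\ maps T x y)) as [L HL].
  { sigma1. }
  { apply sigma1_ext with (fun v => exists i j x y, (forall i, i < v O + 1 -> forall j, j < v O + 1 -> v O <> pr i j) \/
      (v O = pr i j /\ maps e i x /\ maps e j y /\ ~ maps T x y)); [|sigma1].
    intros v; split.
    - intros (i & j & x & y & [H|(E & Hi & Hj & H)]) (i' & j' & x' & y' & E' & Hi' & Hj' & H').
      + eapply H; [| |exact E']; rewrite E'; [apply pr_lt_l|apply pr_lt_r].
      + rewrite E in E'; apply pr_inj in E' as [<- <-]; apply H.
        now rewrite (maps_unique e i x x' He Hi Hi'), (maps_unique e j y y' He Hj Hj').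
    - intros H; destruct (classic (exists i j, v O = pr i j)) as [(i & j & E)|Hp].
      + pose proof He as [_ He']; destruct (He' i) as (x & Hx & _), (He' j) as (y & Hy & _).
        exists i, j, x, y; right; repeat split; auto.
        intros Hxy; apply H; exists i, j, x, y; auto.
      + exists 0, 0, 0, 0; left; intros i _ j _ E; apply Hp; eauto. }
  assert (HL' : forall i j x y, maps e i x -> maps e j y -> maps L i j <-> maps T x y).
  { intros i j x y Hi Hj; unfold maps at 1; rewrite HL; split.
    - intros (i' & j' & x' & y' & E & Hi' & Hj' & H); apply pr_inj in E as [<- <-].
      now rewrite (maps_unique e i x x' He Hi Hi'), (maps_unique e j y y' He Hj Hj').
    - intros H; exists i, j, x, y; auto. }
  assert (Hval : forall i, exists x, maps e i x)
    by (intros i; destruct He as [_ He]; destruct (He i) as (x & Hx & _); eauto).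
  destruct (HADS L) as (F & HF & Hmon).
  { split; [intros z Hz; apply HL in Hz as (i & j & _ & _ & E & _); eauto|].
    split; [|split].
    - intros i; destruct (Hval i) as [x Hx]; rewrite (HL' i i x x); auto.
    - intros i j k; destruct (Hval i) as [x Hx], (Hval j) as [y Hy], (Hval k) as [z Hz].
      rewrite (HL' i j x y), (HL' j k y z), (HL' i k x z); auto.
      apply HST; repeat split; eauto.
    - intros i j Hij; destruct (Hval i) as [x Hx], (Hval j) as [y Hy].
      rewrite (HL' i j x y), (HL' j i y x); auto.
      enough (Hxy : x <> y) by (destruct (Htot x y Hxy); tauto).
      intros <-; destruct (trichotomy i j) as [Hlt'|[E|Hlt']]; [|contradiction|];
        eapply lt_irrefl, Hinc; eauto. }
  assert (HLirr : forall i, ~ maps L i i).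
  { intros i; destruct (Hval i) as [x Hx]; rewrite (HL' i i x x); auto. }
  assert (Hinj : forall i j x, maps F i x -> maps F j x -> i = j).
  { intros i j x Hi Hj; destruct (trichotomy i j) as [Hij|[E|Hij]]; auto;
      destruct (HLirr x), Hmon as [Hmon|Hmon]; eapply Hmon; eauto. }
  (* [F] lists indices; [K] lists the corresponding elements of [S]. It is unbounded because [F] is
     injective and [e] never falls below the identity. *)
  destruct (composition F e HF He) as (K & HK & HKc).
  destruct (increasing_subsequence K HK) as (H & HH & HHK).
  { intros k; destruct (injective_unbounded F HF Hinj k) as (i & x & Hx & Hkx).
    destruct (Hval x) as [y Hy]; exists i, y; split; [eauto|].
    eapply lt_le_trans; [exact Hkx|]; exact (increasing_ge e He Hinc x y Hy). }
  assert (HHF : forall x y, el M x H -> el M y H -> x < y -> exists i j x' y',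
    i < j /\ (maps F i x' /\ maps F j y') /\ maps e x' x /\ maps e y' y).
  { intros x y Hx Hy Hxy; destruct (HHK x y Hx Hy Hxy) as (i & j & Hij & Hix & Hjy).
    assert (Hfac : forall i x, maps K i x -> exists x', maps F i x' /\ maps e x' x).
    { intros i' z Hz; pose proof HF as [_ HF']; destruct (HF' i') as (u & Hu & _).
      destruct (Hval u) as [w Hw]; exists u; split; [exact Hu|].
      now rewrite (maps_unique K i' z w HK Hz (HKc _ _ _ Hu Hw)). }
    destruct (Hfac _ _ Hix) as (x' & Hix' & Hx'), (Hfac _ _ Hjy) as (y' & Hjy' & Hy').
    exists i, j, x', y'; auto. }
  (* For [x < y] in [H], the usual order agrees with the order of appearance in [K]. An ascending
     sequence thus gives arrows from [x] to [y], that is colour 1, and a descending one gives the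
     reverse arrows, that is colour 0. *)
  exists H; split; [exact HH|]; destruct Hmon as [Hmon|Hmon]; [exists 1|exists 0];
    intros x y (Hx & Hy & Hxy); destruct (HHF x y Hx Hy Hxy)
      as (i & j & x' & y' & Hij & Hf & Hx' & Hy');
    pose proof (Hmon i j Hij x' y' Hf) as Hm.
  - now apply (Hlt x y Hxy), (HL' x' y' x y).
  - apply (HL' y' x' y x Hy' Hx'), (Hlt x y Hxy) in Hm.
    destruct (HC x y Hxy) as (c & [-> | ->] & Hc & _); [exact Hc|contradiction].
Qed.

End Model.

Theorem corollary1p13 :
  provable (add_axiom RCA0 EM) RT22 <-> provable (add_axiom RCA0 EM) ADS.
Proof.
  split; intros H; apply NNPP; intros Hn;
    destruct (term_model _ RCA0_EM_subst_closed _ Hn) as (M & Hnamed & Hprov & Hno);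
    assert (HR : forall A, RCA0 A -> holds M A)
      by (intros A HA; apply Hprov, prv_ax; now left);
    apply Hno.
  - apply holds_ADS, RT22_ADS; auto; now apply holds_RT22, Hprov.
  - apply holds_RT22, EM_ADS_RT22; auto.
    + apply holds_EM, Hprov, prv_ax; now right.
    + now apply holds_ADS, Hprov.
Qed.
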